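(* Let $p<q$ be primes. Say that a $C_{pq}$-transfer system $\to$ is realized by a linear isometries operad if $\to\ =\ \to_{\mathcal{L}(U)}$ for some $C_{pq}$-universe $U$. Let $\mathcal{T}_p$ (respectively $\mathcal{T}_q$) be the $C_{pq}$-transfer system whose only nontrivial relation is $C_1\to C_p$ (respectively $C_1\to C_q$). (1) If $p=2$ and $q=3$, then every saturated $C_{pq}$-transfer system except $\mathcal{T}_p$ and $\mathcal{T}_q$ is realized by a linear isometries operad, and $\mathcal{T}_p$ and $\mathcal{T}_q$ are not. (2) If $p=2$ or $3$ and $q>3$, then every saturated $C_{pq}$-transfer system except $\mathcal{T}_q$ is realized by a linear isometries operad, and $\mathcal{T}_q$ is not. (3) If $p,q>3$, then a $C_{pq}$-transfer system is realized by a linear isometries operad if and only if it is saturated.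
   Context: Let $G$ be a finite group and $\mathrm{Sub}(G)$ its set of subgroups. A $G$-transfer system is a partial order $\to$ on $\mathrm{Sub}(G)$ such that: if $K\to H$ then $K\subset H$; if $K\to H$ then $gKg^{-1}\to gHg^{-1}$ for all $g\in G$; if $K\to H$ and $L\subset H$ then $K\cap L\to L$. It is saturated if $K\to H$ and $K\subset L\subset H$ imply $K\to L$ and $L\to H$. A relation $K\to H$ is nontrivial if $K\neq H$. $C_n$ denotes the cyclic group of order $n$, and for $d\mid n$, $C_d\subset C_n$ is its unique subgroup of order $d$. A $G$-universe is a countably infinite dimensional real inner product space $U$ with a linear isometric $G$-action, which contains each of its (finite dimensional) subrepresentations infinitely often, and which contains trivial summands. The linear isometries operad $\mathcal{L}(U)$ has $n$-th level $\mathcal{L}(U)(n)$ the $G\times\Sigma_n$-space of all linear, not necessarily equivariant, isometries $U^{\oplus n}\hookrightarrow U$ ($G$ acts by conjugation, $\Sigma_n$ by permuting summands). For $K\subset H\subset G$ with $n=|H:K|$, let $\Gamma(H/K)=\{(h,\sigma(h))\mid h\in H\}\subset G\times\Sigma_n$ be the graph of a permutation representation $\sigma:H\to\Sigma_n$ of $H/K$. The transfer system $\to_{\mathcal{L}(U)}$ is defined by: $K\to_{\mathcal{L}(U)}H$ iff $K\subset H$ and $\mathcal{L}(U)(n)^{\Gamma(H/K)}\neq\varnothing$. By a known theorem of Blumberg and Hill, for $K\subset H$ this holds iff there is an $H$-equivariant linear embedding $\mathrm{ind}_K^H\mathrm{res}^G_K U\hookrightarrow\mathrm{res}^G_H U$.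 *)

(* Defs.v *)
From HB Require Import structures.
From mathcomp Require Import all_boot all_order all_algebra all_fingroup all_solvable.
From mathcomp Require Import boolp classical_sets reals.

Set Implicit Arguments.
Unset Strict Implicit.
Unset Printing Implicit Defensive.

Import Order.TTheory GRing.Theory Num.Theory.
Local Open Scope ring_scope.

Section TransferSystems.
Variable gT : finGroupType.
Implicit Types (R S : {group gT} -> {group gT} -> Prop) (K L H : {group gT}).

(* The finite group G is the whole type gT, and Sub(G) is {group gT}. Since
   K :^ x is x^-1 K x, the conjugate g K g^-1 is K :^ g^-1. *)
Record transfer_system R : Prop := TransferSystem {
  ts_refl : forall H, R H H;
  ts_anti : forall K H, R K H -> R H K -> K = H;
  ts_trans : forall K L H, R K L -> R L H -> R K H;
  ts_sub : forall K H, R K H -> K \subset H;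
  ts_conj : forall K H, R K H ->
    forall g : gT, R (K :^ g^-1)%G (H :^ g^-1)%G;
  ts_restr : forall K H L, R K H -> L \subset H -> R (K :&: L)%G L
}.

Definition saturated R : Prop :=
  forall K L H, R K H -> K \subset L -> L \subset H -> R K L /\ R L H.

Definition same_relation R S : Prop := forall K H, R K H <-> S K H.

Definition only_nontrivial A B K H : Prop := K = H \/ (K = A /\ H = B).

(* When gT is cyclic and d divides its order, this is its unique subgroup of
   order d: see card_subgroup_of_order and subgroup_of_orderP. *)
Definition subgroup_of_order (d : nat) : {group gT} :=
  <<[set x : gT | (x ^+ d == 1)%g]%SET>>%G.

Lemma subgroup_of_orderP H :
  cyclic [set: gT] -> subgroup_of_order #|H| = H.
Proof.
move=> cG; apply/val_inj/eqP; rewrite /= finset.eqEsubset; apply/andP; split.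
  rewrite gen_subG; apply/fintype.subsetP=> x; rewrite inE => /eqP xd.
  rewrite -cycle_subG -(cardSg_cyclic cG) ?finset.subsetT //.
  by rewrite -orderE order_dvdn xd.
apply/fintype.subsetP=> x Hx; apply: mem_gen; rewrite inE -order_dvdn.
exact: order_dvdG.
Qed.

Lemma card_subgroup_of_order (d : nat) :
  cyclic [set: gT] -> (d %| #|gT|)%N -> #|subgroup_of_order d| = d.
Proof.
move=> /cyclicP[a aG] dG.
have oa : #[a]%g = #|gT| by rewrite orderE -aG cardsT.
have d0 : (0 < #|gT|)%N by rewrite -oa order_gt0.
have od : #|<[(a ^+ (#|gT| %/ d))%g]>%G| = d.
  rewrite /= -orderE orderXdiv oa ?dvdn_div // divnA // mulnC mulnK //.
have cG : cyclic [set: gT] by apply/cyclicP; exists a.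
by rewrite -{1}od subgroup_of_orderP.
Qed.

End TransferSystems.

Section Universes.
Variables (R : realType) (gT : finGroupType).

(* A real inner product space with a linear isometric left action of gT. *)
Record orthogonal_rep := OrthogonalRep {
  rep_space :> lmodType R;
  inner : {dot rep_space for idfun};
  act : gT -> {linear rep_space -> rep_space};
  act1 : forall x, act 1%g x = x;
  actM : forall g h x, act (g * h)%g x = act g (act h x);
  act_isometry : forall g x y, inner (act g x) (act g y) = inner x y
}.

Implicit Type U : orthogonal_rep.

(* Dimension is the algebraic one: a countably infinite Hamel basis. *)
Definition countably_infinite_dim U : Prop :=
  exists b : nat -> U,
    (forall n (c : 'I_n -> R),
       \sum_(i < n) c i *: b i = 0 -> forall i, c i = 0) /\
    (forall x : U, exists n (c : 'I_n -> R), x = \sum_(i < n) c i *: b i).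

Record subrepresentation U (V : set U) : Prop := Subrepresentation {
  subrep0 : V 0;
  subrep_lin : forall (a : R) (x y : U), V x -> V y -> V (a *: x + y);
  subrep_act : forall (g : gT) (x : U), V x -> V (act U g x)
}.

Definition finite_dim U (V : set U) : Prop :=
  exists n (v : 'I_n -> U),
    forall x, V x <-> exists c : 'I_n -> R, x = \sum_(i < n) c i *: v i.

(* The restrictions of the f k to V are equivariant isometric embeddings of V
   in U with pairwise orthogonal images, i.e. they assemble to an embedding of
   a countably infinite direct sum of copies of V. That f k is linear on all of
   U is no restriction, because linear maps on V extend to U. *)
Definition contains_infinitely_often U (V : set U) : Prop :=
  exists f : nat -> {linear U -> U},
    (forall k g x, V x -> f k (act U g x) = act U g (f k x)) /\
    (forall k l x y, V x -> V y ->
       inner U (f k x) (f l y) = if k == l then inner U x y else 0).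

Record is_universe U : Prop := IsUniverse {
  univ_dim : countably_infinite_dim U;
  univ_subrep : forall V : set U,
    subrepresentation V -> finite_dim V -> contains_infinitely_often V;
  univ_trivial : exists2 x : U, x != 0 & forall g, act U g x = x
}.

Definition linear_isometries U n : set ({ffun 'I_n -> U} -> U) :=
  [set f | linear f /\
     forall x y : {ffun 'I_n -> U},
       inner U (f x) (f y) = \sum_(i < n) inner U (x i) (y i)]%classic.
Arguments linear_isometries U n : clear implicits.

(* (g, s) . f = g o f o s^-1 o g^-1, where s sends the j-th summand of U^n to
   the (s j)-th one, so that (s^-1 x) i = x (s i). *)
Definition operad_act U n (gs : gT * 'S_n) (f : {ffun 'I_n -> U} -> U) :
    {ffun 'I_n -> U} -> U :=
  fun x => act U gs.1 (f [ffun i => act U gs.1^-1%g (x (gs.2 i))]).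

Definition operad_fixed U n (Gamma : {set gT * 'S_n}) :
    set ({ffun 'I_n -> U} -> U) :=
  [set f | linear_isometries U n f /\
     forall gs, gs \in Gamma -> operad_act gs f = f]%classic.
Arguments operad_fixed U [n] Gamma.

(* s is the left translation action of H on H / K, read through an enumeration
   e of the left cosets. As perm multiplies from left to right, s reverses
   products when seen as a map into the group 'S_n. *)
Definition coset_perm_rep (K H : {group gT}) n (s : gT -> 'S_n) : Prop :=
  exists e : 'I_n -> {set gT},
    [/\ injective e, [set e i | i : 'I_n]%SET = lcosets K H &
        forall h i, h \in H -> e (s h i) = (h *: e i)%g].

Definition graph (H : {group gT}) n (s : gT -> 'S_n) : {set gT * 'S_n} :=
  [set (h, s h) | h in H]%SET.

(* The choice of s, i.e. of the enumeration of H / K, is immaterial: see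
   operad_fixed_indep. *)
Definition linear_isometries_transfer U (K H : {group gT}) : Prop :=
  K \subset H /\
  exists s : gT -> 'S_(#|H : K|%g),
    coset_perm_rep K H s /\ (operad_fixed U (graph H s) !=set0)%classic.

Lemma operad_actP U n gs (f : {ffun 'I_n -> U} -> U) :
  linear_isometries U n f -> linear_isometries U n (operad_act gs f).
Proof.
case=> lf fi; split=> [a x y|x y].
  rewrite /operad_act -linearP -lf; congr (act U _ (f _)).
  by apply/ffunP=> i; rewrite !ffunE linearP.
rewrite /operad_act act_isometry fi [RHS](reindex_inj (@perm_inj _ gs.2)).
apply: eq_bigr => i _;
by rewrite !ffunE act_isometry.
Qed.

Lemma operad_act_comp U n g h (s t : 'S_n) (f : {ffun 'I_n -> U} -> U) :
  operad_act ((g * h)%g, (t * s)%g) f = operad_act (g, s) (operad_act (h, t) f).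
Proof.
apply/funext=> x; rewrite /operad_act /= actM; congr (act U _ (act U _ (f _))).
by apply/ffunP=> i; rewrite !ffunE invMg actM permM.
Qed.

Lemma operad_fixed_indep U (K H : {group gT}) n (s s' : gT -> 'S_n) :
  coset_perm_rep K H s -> coset_perm_rep K H s' ->
  (operad_fixed U (graph H s) !=set0)%classic ->
  (operad_fixed U (graph H s') !=set0)%classic.
Proof.
move=> [e [ie eH es]] [e' [ie' eH' es']] [f [[lf fi] ff]].
have ex i : exists j, e' j == e i.
  have: e i \in [set e' j | j : 'I_n]%SET by rewrite eH' -eH; apply: imset_f.
  by case/imsetP=> j _ ->; exists j.
pose t i := xchoose (ex i).
have tE i : e' (t i) = e i by apply/eqP/(xchooseP (ex i)).
have it : injective t by move=> i j /(congr1 e'); rewrite !tE; apply: ie.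
exists (fun x => f [ffun i => x (t i)]); split; first split=> [a x y|x y].
- by rewrite -lf; congr f; apply/ffunP=> i; rewrite !ffunE.
- rewrite fi [RHS](reindex_inj it); apply: eq_bigr => i _.
  by rewrite !ffunE.
move=> _ /imsetP[h Hh ->]; apply/funext=> x.
rewrite /operad_act /=.
have -> : f [ffun i => x (t i)] = operad_act (h, s h) f [ffun i => x (t i)].
  by rewrite ff //; apply/imsetP; exists h.
rewrite /operad_act /=; congr (act U _ (f _)); apply/ffunP=> i.
rewrite !ffunE; congr (act U _ (x _)); apply: ie'.
by rewrite es' // !tE es.
Qed.

End Universes.

Definition realized (R : realType) (gT : finGroupType)
    (T : {group gT} -> {group gT} -> Prop) : Prop :=
  exists2 U : orthogonal_rep R gT, is_universe U &
    same_relation T (linear_isometries_transfer U).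

Lemma only_nontrivial_saturated (gT : finGroupType) (p : nat) :
  cyclic [set: gT] -> prime p -> (p %| #|gT|)%N ->
  let T := only_nontrivial (1%G : {group gT}) (subgroup_of_order gT p) in
  transfer_system T /\ saturated T.
Proof.
move=> cG pp pG T.
have cP := card_subgroup_of_order cG pG.
have nP (K : {group gT}) : K \subset subgroup_of_order gT p ->
    K = 1%G \/ K = subgroup_of_order gT p.
  move=> sK; have := cardSg sK; rewrite cP => /(prime_nt_dvdP pp).
  case: (eqVneq #|K| 1%N) => [/card1_trivg K1 _|nK /(_ isT) oK].
    by left; apply/val_inj.
  by right; apply/val_inj/eqP; rewrite eqEcard sK cP oK /=.
have cJ (K : {group gT}) g : (K :^ g)%G = K.
  apply/val_inj/normP.
  by rewrite (fintype.subsetP (sub_abelian_norm (cyclic_abelian cG) (finset.subsetT K))) ?inE.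
split; first split.
- by move=> H; left.
- move=> K H [//|[-> ->]] [//|[<- //]].
- move=> K L H [->//|[-> ->]] [<-|[_ ->]]; by right.
- by move=> K H [->//|[-> _]]; apply: sub1G.
- by move=> K H KH g; rewrite !cJ.
- move=> K H L [->|[-> ->]] sL.
    by left; apply/val_inj/finset.setIidPr.
  have -> : (1 :&: L)%G = 1%G by apply/val_inj/finset.setIidPl/sub1G.
  by case: (nP L sL) => ->; [left|right].
move=> K L H [->|[-> ->]] sKL sLH.
  have -> : L = H by apply/val_inj/eqP; rewrite finset.eqEsubset sLH.
  by split; left.
by case: (nP L sLH) => ->; split; (by left) || (by right).
Qed.

(* Main.v *)
From HB Require Import structures.
From mathcomp Require Import all_boot all_order all_algebra all_fingroup all_solvable.
From mathcomp Require Import boolp classical_sets reals trigo.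
From mathcomp Require Import ring.
Require Import Defs.

(** Write [G] for the cyclic group of order [p q], and [P], [Q] for its
    subgroups of order [p] and [q].

    By Frobenius reciprocity [K -> H] holds for the linear isometries operad of
    [U] iff [U] has a [K]-equivariant isometric endomorphism [F] whose image is
    orthogonal to its translates by the elements of [H] outside [K]
    ([transferP]). In this form the relations of [U] visibly make up a
    transfer system, and averaging [l F l^-1] over an intermediate subgroup [L]
    shows that it is saturated ([linear_isometries_transfer_saturated]).

    Few facts about universes are then needed. A vector with an orthonormal
    [H]-orbit forces [1 -> H] ([orthonormal_orbit_transfer]): it yields
    infinitely many orthogonal regular representations, and an orthonormal basis
    of [U] can be sent to their generators. If [P] acts trivially, [1 -> P]
    fails, while [1 -> Q] gives [P -> G], the embedding for [1 -> Q] serving for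
    [P -> G] as well. If [(1 - y) (1 - z)] kills [U] for [y] in [Q] and [z] in
    [P], then [P -> G] forces [P] to act trivially
    ([transfer_acts_trivially]). Finally, a cubic relation satisfied by an
    element of order greater than [3] excludes a regular orbit
    ([cubic_no_transfer]).

    A saturated transfer system on [G] is determined by the relations [1 -> P],
    [1 -> Q], [P -> G], [Q -> G], and seven combinations occur. Five of them are
    realized for all [p] and [q], by the universes whose characters are: the
    trivial one; all; those trivial on [P]; those trivial on [Q]; those trivial
    on [P] or on [Q]. The relation [1 -> P] alone requires a universe whose
    restriction to [P] contains all characters, whose restriction to [Q]
    contains some nontrivial characters but not all, and such a set of characters
    of [Q], closed under conjugation, exists iff [q > 3]. For [q > 3] a rotation
    of angle [2 pi / q] provides it ([one_sided_realized]); for [q <= 3] a nontrivial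
    action of [Q] produces a regular orbit ([orthonormal_orbit_prime_le3]),
    hence [1 -> Q], whereas a trivial one produces [Q -> G]. The same
    discussion, with [p] and [q] exchanged, decides the relation [1 -> Q]
    alone. *)

Set Implicit Arguments.
Unset Strict Implicit.
Unset Printing Implicit Defensive.

Import Order.TTheory GRing.Theory Num.Theory.

(** * Inner products *)

Section InnerProduct.
Local Open Scope ring_scope.
Variables (R : realType) (gT : finGroupType) (U : orthogonal_rep R gT).
Implicit Types (x y z : U) (a : R) (g h : gT).
Local Notation "''[' x , y ]" := (inner U x y).

Lemma innerC x y : '[x, y] = '[y, x].
Proof. by rewrite hermC expr0 mul1r. Qed.

Lemma innerDl x y z : '[x + y, z] = '[x, z] + '[y, z].
Proof. exact: linearDl. Qed.

Lemma innerZl a x y : '[a *: x, y] = a * '[x, y].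
Proof. exact: linearZl_LR. Qed.

Lemma innerDr x y z : '[x, y + z] = '[x, y] + '[x, z].
Proof. exact: linearDr. Qed.

Lemma innerZr a x y : '[x, a *: y] = a * '[x, y].
Proof. by rewrite innerC innerZl innerC. Qed.

Lemma innerNl x y : '[- x, y] = - '[x, y].
Proof. exact: linearNl. Qed.

Lemma innerNr x y : '[x, - y] = - '[x, y].
Proof. exact: linearNr. Qed.

Lemma inner0l x : '[0, x] = 0.
Proof. exact: linear0l. Qed.

Lemma inner0r x : '[x, 0] = 0.
Proof. exact: linear0r. Qed.

Lemma inner_suml I (r : seq I) (P : pred I) (F : I -> U) y :
  '[\sum_(i <- r | P i) F i, y] = \sum_(i <- r | P i) '[F i, y].
Proof. exact: linear_sumlz. Qed.

Lemma inner_sumr I (r : seq I) (P : pred I) x (F : I -> U) :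
  '[x, \sum_(i <- r | P i) F i] = \sum_(i <- r | P i) '[x, F i].
Proof. exact: linear_sumr. Qed.

Lemma inner_eq0 x : ('[x, x] == 0) = (x == 0).
Proof.
apply/idP/eqP => [|->]; last by rewrite inner0l.
by apply: contraTeq => x0; rewrite gt_eqF// (@neq0_dnorm_gt0 _ _ _ (inner U)).
Qed.

Lemma inner_gt0 x : x != 0 -> 0 < '[x, x].
Proof. exact: (@neq0_dnorm_gt0 _ _ _ (inner U)). Qed.

Lemma inner_ge0 x : 0 <= '[x, x].
Proof.
by case: (eqVneq x 0) => [->|/inner_gt0/ltW//]; rewrite inner0l.
Qed.

Lemma actK g : cancel (act U g) (act U g^-1%g).
Proof. by move=> x; rewrite -actM mulVg act1. Qed.

Lemma actKV g : cancel (act U g^-1%g) (act U g).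
Proof. by move=> x; rewrite -actM mulgV act1. Qed.

Lemma inner_actl g x y : '[act U g x, y] = '[x, act U g^-1%g y].
Proof. by rewrite -(act_isometry g x) actKV. Qed.

Lemma inner_actl2 g h x y :
  '[act U g x, act U h y] = '[act U (h^-1 * g)%g x, y].
Proof. by rewrite actM -[RHS](act_isometry h) actKV. Qed.

Lemma exists_scaled x a : x != 0 -> 0 < a ->
  exists2 b : R, b != 0 & '[b *: x, b *: x] = a.
Proof.
move=> /inner_gt0 x0 a0; exists (Num.sqrt (a / '[x, x])).
  by rewrite sqrtr_eq0 -ltNge divr_gt0.
rewrite innerZl innerZr mulrA -expr2 sqr_sqrtr ?divr_ge0 ?ltW//.
by rewrite divfK// gt_eqF.
Qed.

End InnerProduct.

(** * Frobenius reciprocity *)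

Section InducedEmbedding.
Local Open Scope ring_scope.
Variables (R : realType) (gT : finGroupType) (U : orthogonal_rep R gT).
Implicit Types (K L H : {group gT}).
Local Notation "''[' x , y ]" := (inner U x y).

(** The restriction to the summand of the trivial coset of an [H]-equivariant
    isometry from the sum of [|H : K|] copies of [U] into [U]. *)
Record induced_embedding K H (F : U -> U) : Prop := InducedEmbedding {
  ie_linear : linear F;
  ie_isometry : forall x y, '[F x, F y] = '[x, y];
  ie_equiv : forall k x, k \in K -> F (act U k x) = act U k (F x);
  ie_orth : forall h x y, h \in H -> h \notin K -> '[act U h (F x), F y] = 0
}.

Lemma induced_embeddingB K H F x y : induced_embedding K H F -> F (x - y) = F x - F y.
Proof.
case=> lF _ _ _.
pose Fl : {linear U -> U} := HB.pack F (GRing.isLinear.Build _ _ _ _ F lF).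
exact: (raddfB Fl).
Qed.

(** An isometry fixed by the graph of [H / K] carries the summand of index [i] to
    that of index [s h i] when [h] acts, so its restriction to the summand of
    the trivial coset determines it. *)
Lemma transfer_induced_embedding K H :
  linear_isometries_transfer U K H -> exists F, induced_embedding K H F.
Proof.
case=> sKH [s [[e [ie eH es]] [f [[lf fi] ff]]]].
have [i0 e0] : exists i0, e i0 = K.
  have: (K : {set gT}) \in lcosets K H.
    by apply/lcosetsP; exists 1%g; rewrite ?group1// lcoset1.
  by rewrite -eH => /imsetP[i _ E]; exists i.
pose d i (x : U) : {ffun 'I_(#|H : K|%g) -> U} := [ffun j => if j == i then x else 0].
have dP i a x y : d i (a *: x + y) = a *: d i x + d i y.
  by apply/ffunP=> j; rewrite !ffunE; case: eqP; rewrite ?scaler0 ?addr0.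
(* The fixed point condition, read on a single summand. *)
have fd h i x : h \in H -> act U h (f (d i x)) = f (d (s h i) (act U h x)).
  move=> Hh; have /(congr1 (fun k => k (d (s h i) (act U h x)))) <- :=
    ff (h, s h) (imset_f _ Hh).
  rewrite /operad_act /=; congr (act U _ (f _)); apply/ffunP=> j.
  rewrite !ffunE (inj_eq perm_inj).
  by case: eqP => _; rewrite ?actK ?linear0.
have fdd i j x y : '[f (d i x), f (d j y)] = if i == j then '[x, y] else 0.
  rewrite fi (bigD1 i)//= !ffunE eqxx big1 ?addr0.
    by case: eqP => // _; rewrite inner0r.
  by move=> k /negPf ki; rewrite !ffunE ki inner0l.
(* The stabiliser of the trivial coset is K. *)
have s0 h : h \in H -> (s h i0 == i0) = (h \in K).
  move=> Hh; rewrite -(inj_eq ie) es// e0; apply/eqP/idP => [<-|hK].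
    by rewrite -{1}(mulg1 h) mem_lcoset mulKg group1.
  exact: lcoset_id.
exists (fun x => f (d i0 x)); split=> [a x y|x y|k x kK|h x y hH hK].
- by rewrite dP lf.
- by rewrite fdd eqxx.
- have Hk := fintype.subsetP sKH _ kK.
  by rewrite fd//; move: kK; rewrite -s0// => /eqP->.
- by rewrite fd// fdd s0// (negPf hK).
Qed.

(** The converse spreads [F] over the cosets [r K] as [r F r^-1], which depends
    only on the coset because [F] is [K]-equivariant. *)
Lemma induced_embedding_transfer K H F :
  K \subset H -> induced_embedding K H F -> linear_isometries_transfer U K H.
Proof.
move=> sKH ieF; split=> //.
have cardK : #|lcosets K H| = #|H : K|%g by rewrite card_lcosets.
pose e (i : 'I_(#|H : K|%g)) : {set gT} := enum_val (cast_ord (esym cardK) i).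
have ie : injective e by move=> i j /enum_val_inj/cast_ord_inj.
have eH : [set e i | i : 'I_(#|H : K|%g)]%SET = lcosets K H.
  apply/finset.setP=> A; apply/imsetP/idP => [[i _ ->]|AK]; first exact: enum_valP.
  exists (cast_ord cardK (enum_rank_in AK A)) => //.
  by rewrite /e cast_ordK enum_rankK_in.
have eP i : e i \in lcosets K H by rewrite -eH; apply/imsetP; exists i.
have exs h : exists t : 'S_(#|H : K|%g), h \in H -> forall i, e (t i) = (h *: e i)%g.
  have [Hh|] := boolP (h \in H); last by exists 1%g.
  have /choice[t tP] i : exists j, e j = (h *: e i)%g.
    have: (h *: e i)%g \in lcosets K H.
      have /lcosetsP[x Hx ->] := eP i; apply/lcosetsP; exists (h * x)%g.
        by rewrite groupM.
      by rewrite lcosetM.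
    by rewrite -eH => /imsetP[j _ ->]; exists j.
  have it : injective t.
    by move=> i j /(congr1 e); rewrite !tP => /lcoset_inj/ie.
  by exists (perm it) => _ i; rewrite permE.
have [s sP] := choice exs.
exists s; split; first by exists e; split=> // h i /sP.
have [lF iF eF oF] := ieF.
pose r i := repr (e i).
have re i : r i \in e i.
  have /lcosetsP[x Hx E] := eP i; rewrite /r E; apply: (mem_repr x).
  by rewrite mem_lcoset mulVg group1.
have eE i x : x \in e i -> e i = (x *: K)%g.
  by have /lcosetsP[y Hy ->] := eP i; move/lcoset_eqP => ->.
have Hr i : r i \in H.
  have /lcosetsP[y Hy E] := eP i; have := re i; rewrite E => /lcosetP[k kK ->].
  by rewrite groupM// (fintype.subsetP sKH).
pose f (x : {ffun 'I_(#|H : K|%g) -> U}) :=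
  \sum_i act U (r i) (F (act U (r i)^-1%g (x i))).
have indep g i x : g \in e i ->
    act U g (F (act U g^-1%g x)) = act U (r i) (F (act U (r i)^-1%g x)).
  rewrite (eE _ _ (re i)) => /lcosetP[k kK ->].
  by rewrite invMg !actM eF ?groupV// actKV.
exists f; split; first split.
- move=> a x y; rewrite /f scaler_sumr -big_split; apply: eq_bigr => i _.
  by rewrite !ffunE !linearP lF linearP.
- move=> x y; rewrite /f inner_suml; apply: eq_bigr => i _.
  rewrite inner_sumr (bigD1 i)//= big1 ?addr0; last first.
    move=> j ji; rewrite inner_actl2 oF//; first by rewrite groupM ?groupV.
    apply: contra ji => jiK; rewrite -(inj_eq ie) (eE _ _ (re i)) (eE _ _ (re j)).
    by apply/eqP/lcoset_eqP; rewrite mem_lcoset -groupV invMg invgK.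
  by rewrite act_isometry iF act_isometry.
- move=> _ /imsetP[h Hh ->]; apply/funext=> x; rewrite /operad_act /f /=.
  rewrite linear_sum [RHS](reindex_inj (@perm_inj _ (s h))) /=.
  apply: eq_bigr => i _; rewrite !ffunE -!actM -invMg.
  by rewrite (indep _ (s h i))// sP// mem_lcoset mulKg.
Qed.

(** Frobenius reciprocity: an [H]-map out of the [H/K]-indexed sum of copies
    of [U] is the same thing as a [K]-map out of the summand indexed by the
    trivial coset, and it is isometric iff that [K]-map is isometric and its
    translates under [H/K] are pairwise orthogonal. *)
Lemma transferP K H :
  linear_isometries_transfer U K H <->
  K \subset H /\ exists F, induced_embedding K H F.
Proof.
split=> [t|[sKH [F]]]; last exact: induced_embedding_transfer.
by split; [case: t|exact: transfer_induced_embedding].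
Qed.

End InducedEmbedding.

Arguments induced_embedding {R gT} U K H F.

(** * The transfer system of a linear isometries operad *)

Section TransferSystem.
Local Open Scope ring_scope.
Variables (R : realType) (gT : finGroupType) (U : orthogonal_rep R gT).
Implicit Types (K L H : {group gT}).
Local Notation "''[' x , y ]" := (inner U x y).

Lemma ie_id H : induced_embedding U H H (fun x => x).
Proof. by split=> // h x y ->. Qed.

Lemma ie_comp K L H F1 F2 : K \subset L ->
  induced_embedding U L H F1 -> induced_embedding U K L F2 ->
  induced_embedding U K H (fun x => F1 (F2 x)).
Proof.
move=> sKL [l1 i1 e1 o1] [l2 i2 e2 o2]; split=> [a x y|x y|k x kK|h x y hH hK].
- by rewrite l2 l1.
- by rewrite i1 i2.
- by rewrite e2// e1// (fintype.subsetP sKL).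
- have [hL|hL] := boolP (h \in L); last exact: o1.
  by rewrite -e1// i1 o2.
Qed.

Lemma ie_conj K H F (g : gT) : induced_embedding U K H F ->
  induced_embedding U (K :^ g^-1)%G (H :^ g^-1)%G
    (fun x => act U g (F (act U g^-1%g x))).
Proof.
have gE h : (g^-1 * h)%g = (h ^ g * g^-1)%g by rewrite conjgE !mulgA mulgK.
move=> [l i e o]; split=> [a x y|x y|k x|h x y].
- by rewrite linearP l linearP.
- by rewrite act_isometry i act_isometry.
- rewrite mem_conjg invgK => kK.
  by rewrite -actM gE actM e// -!actM conjgE !mulgA mulgV mul1g.
- rewrite !mem_conjg invgK => hH hK.
  by rewrite -actM inner_actl2 -conjgE o.
Qed.

Lemma ie_restr K H L F : L \subset H ->
  induced_embedding U K H F -> induced_embedding U (K :&: L)%G L F.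
Proof.
move=> sLH [l i e o]; split=> // [k x|h x y hL].
  by rewrite inE => /andP[kK _]; exact: e.
by rewrite inE hL andbT => hK; apply: o => //; apply: (fintype.subsetP sLH).
Qed.

(** The diagonal embedding of [H/L] copies of [U] in [H/K] copies: averaging
    [l F l^-1] over [L] sums [|L : K|] orthogonal isometries, each counted
    [|K|] times, which accounts for the normalisation. *)
Lemma ie_average K L H F : K \subset L -> L \subset H ->
  induced_embedding U K H F ->
  induced_embedding U L H (fun x =>
    (Num.sqrt (#|L| * #|K|)%:R)^-1 *:
      \sum_(l in L) act U l (F (act U l^-1%g x))).
Proof.
move=> sKL sLH [lF iF eF oF]; set c := _^-1.
have c2 : c * c * (#|L| * #|K|)%:R = 1.
  rewrite -invfM -expr2 sqr_sqrtr ?ler0n// mulVf//.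
  by rewrite pnatr_eq0 -lt0n muln_gt0 !cardG_gt0.
have inner_terms l l' x y : l \in L -> l' \in L ->
    '[act U l (F (act U l^-1%g x)), act U l' (F (act U l'^-1%g y))] =
    if l' \in (l *: K)%g then '[x, y] else 0.
  move=> Ll Ll'; rewrite innerC inner_actl2 mem_lcoset.
  have [kK|nK] := boolP (_ \in K).
    by rewrite -eF// iF -actM -mulgA mulgV mulg1 act_isometry innerC.
  by rewrite oF// (fintype.subsetP sLH)// groupM ?groupV.
split=> [a x y|x y|m x mL|h x y hH hL].
- rewrite scalerA mulrC -scalerA -scalerDr; congr (_ *: _).
  rewrite scaler_sumr -big_split; apply: eq_bigr => l _ /=.
  by rewrite linearP lF linearP.
- rewrite innerZl innerZr mulrA -[RHS]mul1r -c2 -[RHS]mulrA; congr (_ * _).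
  rewrite inner_suml (eq_bigr (fun _ => #|K|%:R * '[x, y])) => [|l Ll].
    by rewrite sumr_const -mulrnAl natrM mulr_natl.
  rewrite inner_sumr; under eq_bigr => l' Ll' do rewrite inner_terms//.
  rewrite -big_mkcondr /= (eq_bigl (mem (l *: K)%g)) => [|l' /=].
    by rewrite sumr_const card_lcoset mulr_natl.
  rewrite andb_idl// => /lcosetP[k kK ->].
  by rewrite groupM// (fintype.subsetP sKL).
- rewrite linearZ; congr (_ *: _); rewrite linear_sum.
  rewrite (reindex_inj (mulgI m)) /=; apply: eq_big => [l|l _].
    by rewrite groupMl.
  by rewrite invMg !actM actK.
- rewrite [act U h _]linearZ innerZl innerZr [act U h _]linear_sum inner_suml.
  rewrite big1 ?mulr0// => l Ll; rewrite inner_sumr big1// => l' Ll'.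
  rewrite -actM inner_actl2 oF//; last apply: contra hL => hK.
    by rewrite !groupM ?groupV// (fintype.subsetP sLH).
  have := fintype.subsetP sKL _ hK; rewrite groupMl ?groupV//.
  by rewrite groupMr.
Qed.

(** Once transfers are described by embeddings [F], restriction along [L]
    keeps the same [F], composition composes them and conjugation conjugates
    them. *)
Lemma linear_isometries_transfer_system :
  transfer_system (linear_isometries_transfer U).
Proof.
split=> [H|K H|K L H|K H|K H|K H L].
- by apply/transferP; split=> //; exists (fun x => x); apply: ie_id.
- move=> /transferP[sKH _] /transferP[sHK _].
  by apply/val_inj/eqP; rewrite finset.eqEsubset sKH sHK.
- move=> /transferP[sKL [F2 ie2]] /transferP[sLH [F1 ie1]].
  apply/transferP; split; first exact: fintype.subset_trans sKL sLH.
  by exists (fun x => F1 (F2 x)); apply: ie_comp ie1 ie2.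
- by case.
- move=> /transferP[sKH [F ieF]] g; apply/transferP; split.
    by rewrite conjSg.
  by eexists; apply: ie_conj ieF.
- move=> /transferP[sKH [F ieF]] sLH; apply/transferP; split.
    exact: subsetIr.
  by exists F; apply: ie_restr ieF.
Qed.

Lemma linear_isometries_transfer_saturated :
  saturated (linear_isometries_transfer U).
Proof.
move=> K L H /[dup] tKH /transferP[sKH [F ieF]] sKL sLH; split.
  have := ts_restr linear_isometries_transfer_system tKH sLH.
  by rewrite (_ : (K :&: L)%G = K)//; apply/val_inj/finset.setIidPl.
by apply/transferP; split=> //; eexists; apply: ie_average ieF.
Qed.

End TransferSystem.

(** * Orthonormal orbits and Gram-Schmidt families *)

Section GramSchmidt.
Local Open Scope ring_scope.
Variables (R : realType) (gT : finGroupType) (U : orthogonal_rep R gT).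
Local Notation "''[' x , y ]" := (inner U x y).

Definition normalize (x : U) : U := (Num.sqrt '[x, x])^-1 *: x.

Lemma normalizeE x : x = Num.sqrt '[x, x] *: normalize x.
Proof.
have [->|x0] := eqVneq x 0; first by rewrite /normalize !scaler0.
by rewrite scalerA divff ?scale1r// sqrtr_eq0 -ltNge inner_gt0.
Qed.

Lemma normalize_idem x : '[normalize x, normalize x] *: normalize x = normalize x.
Proof.
have [->|x0] := eqVneq x 0; first by rewrite /normalize !scaler0.
rewrite {1 2}/normalize innerZl innerZr mulrA -invfM -expr2 sqr_sqrtr ?inner_ge0//.
by rewrite mulVf ?scale1r// inner_eq0.
Qed.

Section Expansion.
Variable e : nat -> U.

(** The expansion is stable: it uses finitely many members of the family, whatever
    the truncation beyond them. *)
Definition expands x := exists N, forall n, (N <= n)%N ->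
  x = \sum_(k < n) '[x, e k] *: e k.

Lemma expandsP a x y : expands x -> expands y -> expands (a *: x + y).
Proof.
move=> [N xN] [M yM]; exists (maxn N M) => n; rewrite geq_max => /andP[Nn Mn].
rewrite {1}(xN n Nn) {1}(yM n Mn) scaler_sumr -big_split; apply: eq_bigr => k _.
by rewrite /= innerDl innerZl scalerDl scalerA.
Qed.

Lemma expands0 : expands 0.
Proof. by exists 0%N => n _; rewrite big1// => i _; rewrite inner0l scale0r. Qed.

Lemma expandsZ a x : expands x -> expands (a *: x).
Proof. by move=> ex; rewrite -[_ *: _]addr0; apply: expandsP => //; apply: expands0. Qed.

Lemma expands_sum I (r : seq I) (P : pred I) (v : I -> U) :
  (forall i, expands (v i)) -> expands (\sum_(i <- r | P i) v i).
Proof.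
move=> ev; elim/big_ind: _ => // [|x y ex ey]; first exact: expands0.
by rewrite -[x]scale1r; apply: expandsP.
Qed.

Lemma expands_self i : (forall j, i != j -> '[e i, e j] = 0) ->
  '[e i, e i] *: e i = e i -> expands (e i).
Proof.
move=> orth idem; exists i.+1 => n lt_in; rewrite (bigD1 (Ordinal lt_in))//= idem.
by rewrite big1 ?addr0// => k ki; rewrite orth ?scale0r// eq_sym.
Qed.

End Expansion.

Section Orthogonalization.
Variable b : nat -> U.

Fixpoint gram_schmidt_seq n : seq U :=
  if n is m.+1 then
    let s := gram_schmidt_seq m in
    rcons s (normalize (b m - \sum_(v <- s) '[b m, v] *: v))
  else [::].

(** As [normalize 0 = 0], a vector that depends on the earlier ones contributes
    [0]; the family is therefore described by [<e, e> e = e], which covers both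
    zero and unit vectors. *)
Definition gram_schmidt n : U :=
  normalize (b n - \sum_(v <- gram_schmidt_seq n) '[b n, v] *: v).
Local Notation e := gram_schmidt.

Lemma gram_schmidtE n :
  e n = normalize (b n - \sum_(i < n) '[b n, e i] *: e i).
Proof.
have seqE m : gram_schmidt_seq m = [seq e i | i <- iota 0 m].
  by elim: m => // m IH; rewrite -addn1 iotaD map_cat cats1 /= addn1 /= -IH.
by rewrite {1}/gram_schmidt seqE big_map -{2}[n]subn0 big_mkord.
Qed.

Lemma gram_schmidt_idem n : '[e n, e n] *: e n = e n.
Proof. exact: normalize_idem. Qed.

Lemma gram_schmidt_orthogonal_lt n i : (i < n)%N -> '[e n, e i] = 0.
Proof.
elim/ltn_ind: n i => n IH i lt_in.
have orth j k : (j < n)%N -> (k < n)%N -> j != k -> '[e j, e k] = 0.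
  by move=> jn kn; case: ltngtP => // [jk _|kj _]; [rewrite innerC|]; apply: IH.
rewrite gram_schmidtE; set v := b n - _.
suff v0 : '[v, e i] = 0 by rewrite /normalize innerZl v0 mulr0.
rewrite /v innerDl innerNl inner_suml.
rewrite (bigD1 (Ordinal lt_in))//= big1 => [|j ji]; last first.
  by rewrite innerZl orth ?mulr0.
by rewrite addr0 innerZl mulrC -innerZr gram_schmidt_idem subrr.
Qed.

Lemma gram_schmidt_orthogonal i j : i != j -> '[e i, e j] = 0.
Proof.
by case: ltngtP => // ij _; [rewrite innerC|]; apply: gram_schmidt_orthogonal_lt.
Qed.

Lemma expands_generator n : expands e (b n).
Proof.
rewrite -[b n](subrK (\sum_(i < n) '[b n, e i] *: e i)).
have ee i : expands e (e i).
  apply: expands_self; last exact: gram_schmidt_idem.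
  by move=> j; apply: gram_schmidt_orthogonal.
rewrite [X in X + _]normalizeE -gram_schmidtE; apply: expandsP => //.
by apply: expands_sum => i; apply: expandsZ.
Qed.

End Orthogonalization.

(** Parseval's identity for the Gram-Schmidt family of a Hamel basis: every
    vector has finitely many nonzero coordinates, all of index below [N x]. *)
Lemma parseval : countably_infinite_dim U ->
  exists (e : nat -> U) (N : U -> nat),
    (forall x k, (N x <= k)%N -> '[x, e k] = 0) /\
    (forall x y n, (N x <= n)%N -> '[x, y] = \sum_(k < n) '[x, e k] * '[y, e k]).
Proof.
case=> b [_ bspan]; pose e := gram_schmidt b.
have /choice[N NP] x : expands e x.
  have [n [c ->]] := bspan x.
  by apply: expands_sum => i; apply: expandsZ; apply: expands_generator.
exists e, N; split=> [x k Nk|x y n /NP xn].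
  rewrite (NP x k Nk) inner_suml big1// => i _.
  by rewrite innerZl gram_schmidt_orthogonal ?mulr0// ltn_eqF.
rewrite {1}xn inner_suml; apply: eq_bigr => k _.
by rewrite innerZl; congr (_ * _); apply: innerC.
Qed.

End GramSchmidt.

Section RegularOrbit.
Local Open Scope ring_scope.
Variables (R : realType) (gT : finGroupType) (U : orthogonal_rep R gT).
Implicit Type H : {group gT}.
Local Notation "''[' x , y ]" := (inner U x y).

Definition orthonormal_orbit H (u : U) : Prop :=
  forall h, h \in H -> '[act U h u, u] = (h == 1%g)%:R.

(** A universe is assumed to absorb infinitely many copies of its
    finite-dimensional subrepresentations, so the copies are taken of the span
    of the orbit of [u]: the images [w k] of [u] generate infinitely many
    orthogonal copies of the regular representation of [H]. The coordinates of a
    vector of [U] are then distributed over the [w k]. *)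
Lemma orthonormal_orbit_transfer H (u : U) :
  is_universe U -> orthonormal_orbit H u -> linear_isometries_transfer U 1%G H.
Proof.
move=> [Udim Usub _] Hu.
pose V : set U := [set x | exists c : gT -> R, x = \sum_g c g *: act U g u]%classic.
have sV : subrepresentation V.
  split=> [|a _ _ [c ->] [d ->]|g _ [c ->]].
  - by exists (fun=> 0); rewrite big1// => g _; rewrite scale0r.
  - exists (fun g => a * c g + d g); rewrite scaler_sumr -big_split.
    by apply: eq_bigr => g _ /=; rewrite scalerDl scalerA.
  - exists (fun h => c (g^-1 * h)%g); rewrite linear_sum [RHS](reindex_inj (mulgI g)).
    by apply: eq_bigr => h _; rewrite mulKg actM linearZ.
have fV : finite_dim V.
  have bij : {on [pred _ | true], bijective (@enum_val gT gT)}.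
    exact: onW_bij (@enum_val_bij gT).
  exists #|gT|, (fun i => act U (enum_val i) u) => x; split=> [[c ->]|[c ->]].
    by exists (fun i => c (enum_val i)); rewrite (reindex _ bij).
  exists (fun g => c (enum_rank g)); rewrite [RHS](reindex _ bij).
  by apply: eq_bigr => i _; rewrite enum_valK.
have [f [feq fiso]] := Usub V sV fV.
have Vu g : V (act U g u).
  exists (fun h => (h == g)%:R); rewrite (bigD1 g)//= eqxx scale1r big1 ?addr0//.
  by move=> h /negPf->; rewrite scale0r.
pose w k := f k u.
have Vu1 : V u by rewrite -[u]act1.
have wP h k l : h \in H ->
    '[act U h (w k), w l] = ((k == l) && (h == 1%g))%:R.
  by move=> Hh; rewrite -feq// fiso//; case: eqP => //= _; rewrite Hu.
have [e [N [N0 eN]]] := parseval Udim.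
pose F x := \sum_(k < N x) '[x, e k] *: w k.
(* F may be computed with any large enough truncation, which makes it linear. *)
have FE x n : (N x <= n)%N -> F x = \sum_(k < n) '[x, e k] *: w k.
  move=> Nn; rewrite /F (big_ord_widen_cond n xpredT (fun k => '[x, e k] *: w k))//.
  rewrite [RHS](bigID (fun k : 'I_n => (k < N x)%N))/= [X in _ + X]big1 ?addr0//.
  by move=> k; rewrite -leqNgt => /N0->; rewrite scale0r.
have innerF h x y : h \in H -> '[act U h (F x), F y] = (h == 1%g)%:R * '[x, y].
  move=> Hh; pose n := maxn (N x) (N y).
  have xn : (N x <= n)%N by rewrite leq_maxl.
  rewrite (FE x n)// (FE y n) ?leq_maxr// (eN x y n)// mulr_sumr.
  rewrite [act U h _]linear_sum inner_suml; apply: eq_bigr => k _.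
  rewrite [act U h _]linearZ innerZl inner_sumr (bigD1 k)//= big1 ?addr0.
    by rewrite innerZr wP// eqxx /=; ring.
  by move=> l lk; rewrite innerZr wP// eq_sym (inj_eq val_inj) (negPf lk) mulr0.
apply/transferP; split; first exact: sub1G.
exists F; split=> [a x y|x y|k x|h x y Hh].
- pose n := maxn (N (a *: x + y)) (maxn (N x) (N y)).
  rewrite (FE _ n) ?leq_maxl// (FE x n) ?(FE y n) ?leq_max ?leqnn ?orbT//.
  rewrite scaler_sumr -big_split; apply: eq_bigr => k _ /=.
  by rewrite innerDl innerZl scalerDl scalerA.
- by have := innerF 1%g x y (group1 H); rewrite act1 eqxx mul1r.
- by rewrite inE => /eqP->; rewrite !act1.
- by rewrite inE innerF// => /negPf->; rewrite mul0r.
Qed.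

End RegularOrbit.

(** * Criteria for transfers *)

Section TransferCriteria.
Local Open Scope ring_scope.
Variables (R : realType) (gT : finGroupType) (U : orthogonal_rep R gT).
Hypothesis U_universe : is_universe U.
Implicit Types K L H P Q : {group gT}.
Local Notation "''[' x , y ]" := (inner U x y).

Definition acts_trivially H : Prop := forall h x, h \in H -> act U h x = x.

(** Outside [K], an element of [H] moves the image of an embedding to an
    orthogonal subspace, so it cannot act as the identity. *)
Lemma acts_trivially_no_transfer K P H : linear_isometries_transfer U K H ->
  P \subset H -> acts_trivially P -> P \subset K.
Proof.
move=> /transferP[_ [F [_ iF _ oF]]] sPH trP; have [_ _ [t t0 _]] := U_universe.
apply/fintype.subsetP=> h Ph; apply: contraNT t0 => hK.
rewrite -inner_eq0 -iF -[X in '[X, _]](trP h)// oF//.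
exact: fintype.subsetP sPH _ Ph.
Qed.

(** If [P] acts trivially, the translates of an embedding under [P * Q] are
    its translates under [Q]. *)
Lemma acts_trivially_transfer P Q H : acts_trivially P ->
  P :&: Q = 1%g -> (P * Q)%g = H ->
  linear_isometries_transfer U 1%G Q -> linear_isometries_transfer U P H.
Proof.
move=> trP tiPQ PQ /transferP[_ [F [lF iF _ oF]]]; apply/transferP.
split; first by rewrite -PQ mulG_subl.
exists F; split=> // [k x kP|h x y]; first by rewrite !trP.
rewrite -PQ => /mulsgP[a b aP bQ ->] abP.
rewrite actM trP// oF// inE; apply: contra abP => /eqP->.
by rewrite mulg1.
Qed.

(** The image of [1 - z] is mapped by an embedding into the image of [1 - z],
    where [y] acts as the identity; but for [y] outside [K] the embedding is
    orthogonal to its translate by [y]. *)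
Lemma transfer_acts_trivially K L H :
  linear_isometries_transfer U K H -> L \subset H -> ~~ (L \subset K) ->
  (forall y z x, y \in L -> z \in K ->
     act U y (x - act U z x) = x - act U z x) ->
  acts_trivially K.
Proof.
move=> /transferP[_ [F ieF]] sLH /fintype.subsetPn[y yL yK] yz z x zK.
have [lF iF eF oF] := ieF; apply/esym/eqP; rewrite -subr_eq0 -inner_eq0 -iF.
have Fw : F (x - act U z x) = F x - act U z (F x) by rewrite (induced_embeddingB _ _ ieF) eF.
by rewrite {1}Fw -(yz y)// -Fw oF// (fintype.subsetP sLH).
Qed.

(** A regular orbit is linearly independent, so no element of order greater
    than [3] satisfies the cubic relation
    [(z - 1) (z ^+ 2 - 2 c z + 1) = 0]. *)
Lemma cubic_no_transfer H (z : gT) (c : R) :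
  z \in H -> (3 < #[z]%g)%N ->
  (forall x, let w := act U z x - x in
     act U z (act U z w) - (c + c) *: act U z w + w = 0) ->
  ~ linear_isometries_transfer U 1%G H.
Proof.
move=> zH oz cubic /transferP[_ [F [_ iF _ oF]]].
have [_ _ [t t0 _]] := U_universe; case/eqP: t0.
have orth k : (0 < k < 4)%N -> '[act U (z ^+ k)%g (F t), F t] = 0.
  move=> /andP[k0 k4]; rewrite oF//; first by rewrite groupX.
  by rewrite inE -order_dvdn gtnNdvd//; apply: leq_trans k4 oz.
have o1 := orth 1%N isT; have o2 := orth 2%N isT; have o3 := orth 3%N isT.
rewrite !expgS expg0 mulg1 !actM in o1 o2 o3.
have := congr1 (fun x => '[x, F t]) (cubic (F t)).
rewrite /= !linearB /= inner0l !(innerDl, innerNl, innerZl) o1 o2 o3 iF.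
by rewrite !(subr0, sub0r, oppr0, mulr0, addr0, add0r) => /eqP; rewrite oppr_eq0 inner_eq0 => /eqP.
Qed.

(** Let [z] generate [H] and [p := #|H|]. For [p <= 3] the nontrivial elements of
    [H] are [z] and [z^-1], so all
    nontrivial translates of [w := x - z x] have the same inner product with
    [w]; as the translates of [w] add up to [0], this product is
    [- '[w, w] / (p - 1)], and adding to [w] a fixed vector of the right length
    makes the translates orthogonal. *)
Lemma orthonormal_orbit_prime_le3 H :
  prime #|H| -> (#|H| <= 3)%N -> ~ acts_trivially H ->
  exists u : U, orthonormal_orbit H u.
Proof.
move=> pH H3 ntrivial; have [_ _ [t t0 tfix]] := U_universe.
have /cyclicP[z Hz] := prime_cyclic pH.
have zH : z \in H by rewrite Hz cycle_id.
have [x zx] : exists x, act U z x != x.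
  apply: contrapT => nx; apply: ntrivial => h x; rewrite Hz => /cycleP[k ->].
  elim: k => [|k IH]; first by rewrite act1.
  by rewrite expgS actM IH; apply: contrapT => /eqP zx; apply: nx; exists x.
pose p := #|H|; have p1 : (1 < p)%N by apply: prime_gt1.
have pR : 0 < (p%:R : R) by rewrite ltr0n ltnW.
have p1R : 0 < (p%:R - 1 : R) by rewrite subr_gt0 ltr1n.
have w0 : x - act U z x != 0 by rewrite subr_eq0 eq_sym.
(* The squared lengths (p - 1) / p and 1 / p add up to 1, and the second one
   compensates the inner product - 1 / p of w with its translates. *)
have [b _ wb] := exists_scaled w0 (divr_gt0 p1R pR).
have [d _ td] := exists_scaled t0 (divr_gt0 ltr01 pR).
set w := b *: _ in wb; set s := d *: t in td.
have sfix h : act U h s = s by rewrite /s linearZ /= tfix.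
have sw : '[s, w] = 0.
  by rewrite /w innerZr innerDr innerNr -{2}(sfix z) act_isometry subrr mulr0.
have sum0 : \sum_(h in H) act U h w = 0.
  rewrite /w; under eq_bigr do rewrite linearZ linearB /=.
  rewrite -scaler_sumr sumrB [X in X - _](reindex_inj (mulIg z)) /=.
  rewrite (eq_bigl (mem H)) => [|h /=]; last by rewrite groupMr.
  by under eq_bigr do rewrite actM; rewrite subrr scaler0.
(* Here p <= 3 is used: z ^+ 2 = z^-1 when p = 3. *)
have same h : h \in H -> h != 1%g -> '[act U h w, w] = '[act U z w, w].
  rewrite Hz => /cyclePmin[[|[|k]] kp ->]; rewrite ?expg0 ?expg1 ?eqxx// => _.
  have oz : #[z]%g = 3%N.
    by apply/eqP; rewrite eqn_leq (leq_trans _ kp)// orderE -Hz H3.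
  have -> : k = 0%N by move: kp; rewrite oz; case: k.
  have -> : (z ^+ 2 = z^-1)%g by apply/eqP; rewrite eq_sym eq_invg_mul -expgS -oz expg_order.
  by rewrite inner_actl invgK innerC.
have c0 : '[act U z w, w] = - (p%:R^-1).
  have := congr1 (fun y => '[y, w]) sum0; rewrite inner_suml inner0l.
  rewrite (bigD1 1%g)//= act1 (eq_bigr (fun=> '[act U z w, w])) => [|h /andP[]].
    rewrite sumr_const wb; have -> : #|[pred i in H | i != 1%g]| = p.-1.
      by rewrite /p (cardsD1 1%g) group1; apply: eq_card => i; rewrite !inE andbC.
    rewrite -[_ *+ p.-1]mulr_natl -subn1 natrB ?(ltnW p1)// => /eqP.
    have n0 : p%:R - 1 != 0 :> R by rewrite gt_eqF.
    rewrite -mulrDr mulf_eq0 (negPf n0) /= addrC addr_eq0 => /eqP.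
    by [].
  exact: same.
exists (s + w) => h Hh; rewrite [act U h _]linearD sfix innerDl !innerDr td sw.
have -> : '[act U h w, s] = 0 by rewrite innerC -{1}(sfix h) act_isometry sw.
have [->|h1] := eqVneq h 1%g.
  by rewrite act1 wb addr0 add0r -mulrDl addrC subrK divff// gt_eqF.
by rewrite same// c0 addr0 add0r div1r subrr.
Qed.

End TransferCriteria.

(** * The universe generated by a finite-dimensional representation *)

Section CoefficientProduct.
Local Open Scope ring_scope.
Variable R : realType.
Implicit Types p q : {poly R}.

(** Polynomials serve as finitely supported sequences; sums over their supports
    are compared after extending them to a common bound. *)
Lemma big_size_widen (V : nmodType) p n (F : nat -> V) : (size p <= n)%N ->
  (forall i, p`_i = 0 -> F i = 0) -> \sum_(i < size p) F i = \sum_(i < n) F i.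
Proof.
move=> pn F0; rewrite (big_ord_widen_cond n xpredT F)//.
rewrite [RHS](bigID (fun k : 'I_n => (k < size p)%N))/= [X in _ + X]big1 ?addr0//.
by move=> k; rewrite -leqNgt => pk; rewrite F0// nth_default.
Qed.

Definition coef_dot p q : R := \sum_(i < size p) p`_i * q`_i.

Lemma coef_dotE n p q : (size p <= n)%N -> coef_dot p q = \sum_(i < n) p`_i * q`_i.
Proof. move=> pn; apply: (big_size_widen (F := fun i => p`_i * q`_i) pn).
by move=> i ->; rewrite mul0r. Qed.

Lemma coef_dotC p q : coef_dot p q = coef_dot q p.
Proof.
pose n := maxn (size p) (size q).
rewrite (@coef_dotE n) ?leq_maxl// (@coef_dotE n q) ?leq_maxr//.
by apply: eq_bigr => i _; rewrite mulrC.
Qed.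

Lemma coef_dot_linear q : linear_for *%R (coef_dot^~ q).
Proof.
move=> a x y /=; pose n := maxn (size (a *: x + y)) (maxn (size x) (size y)).
rewrite !(@coef_dotE n) ?leq_max ?leqnn ?orbT// mulr_sumr -big_split.
by apply: eq_bigr => i _; rewrite coefD coefZ mulrDl mulrA.
Qed.

Lemma coef_dot_ge0 p : 0 <= coef_dot p p.
Proof. by apply: sumr_ge0 => i _; rewrite -expr2 sqr_ge0. Qed.

Lemma coef_dot_gt0 p : p != 0 -> 0 < coef_dot p p.
Proof.
move=> p0; rewrite lt_neqAle coef_dot_ge0 andbT eq_sym psumr_neq0 => [|i _].
  have sp : ((size p).-1 < size p)%N by rewrite prednK// size_poly_gt0.
  apply/hasP; exists (Ordinal sp); first by rewrite mem_index_enum.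
  by rewrite /= -expr2 exprn_even_gt0//= -lead_coefE lead_coef_eq0.
by rewrite -expr2 sqr_ge0.
Qed.

Lemma coef_dotXn m n : coef_dot 'X^m 'X^n = (m == n)%:R.
Proof.
rewrite /coef_dot size_polyXn (bigD1 ord_max)//= big1 => [|i im].
  by rewrite !coefXn eqxx mul1r addr0 eq_sym.
by rewrite coefXn -[m]/(val (@ord_max m)) (inj_eq val_inj) (negPf im) mul0r.
Qed.

(** Infinitely many isometries of the space of finite sequences with pairwise
    orthogonal images, from an injection of the pairs of numbers in the
    numbers. *)
Definition shift (k : nat) p : {poly R} :=
  \sum_(i < size p) p`_i *: 'X^(pickle (k, i : nat)).

Lemma shiftE k n p : (size p <= n)%N ->
  shift k p = \sum_(i < n) p`_i *: 'X^(pickle (k, i : nat)).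
Proof.
move=> pn; apply: (big_size_widen (F := fun i => p`_i *: 'X^(pickle (k, i))) pn).
by move=> i ->; rewrite scale0r.
Qed.

Lemma shift_linear k : linear (shift k).
Proof.
move=> a x y; pose n := maxn (size (a *: x + y)) (maxn (size x) (size y)).
rewrite !(@shiftE _ n) ?leq_max ?leqnn ?orbT// scaler_sumr -big_split.
by apply: eq_bigr => i _; rewrite coefD coefZ scalerDl scalerA.
Qed.

End CoefficientProduct.

Section Amplification.
Local Open Scope ring_scope.
Variables (R : realType) (gT : finGroupType).

(** An orthogonal representation with a chosen orthonormal basis, so that direct
    sums and sums of infinitely many copies are families of coordinates. *)
Record matrix_rep := MatrixRep {
  mr_index : finType;
  mr_coef : gT -> mr_index -> mr_index -> R;
  mr_coef1 : forall s t, mr_coef 1%g s t = (s == t)%:R;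
  mr_coefM : forall g h s t,
    mr_coef (g * h)%g s t = \sum_r mr_coef g s r * mr_coef h r t;
  mr_orthogonal : forall g s t,
    \sum_r mr_coef g r s * mr_coef g r t = (s == t)%:R
}.
Variable M : matrix_rep.
Local Notation I := (mr_index M).
Local Notation W := {ffun I -> {poly R}}.

Definition amp_act (g : gT) (x : W) : W :=
  [ffun s => \sum_t mr_coef g s t *: x t].

Lemma amp_act_linear g : linear (amp_act g).
Proof.
move=> a x y; apply/ffunP=> s; rewrite !ffunE scaler_sumr -big_split.
apply: eq_bigr => t _; rewrite !ffunE /= scalerDr !scalerA.
by rewrite [a * _]mulrC.
Qed.
HB.instance Definition _ g := GRing.isLinear.Build R W W *:%R (amp_act g)
  (amp_act_linear g).

Definition amp_inner (x y : W) : R := \sum_s coef_dot (x s) (y s).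

Lemma amp_innerC x y : amp_inner x y = amp_inner y x.
Proof. by apply: eq_bigr => s _; rewrite coef_dotC. Qed.

Lemma amp_inner_linear y : linear_for *%R (amp_inner^~ y).
Proof.
move=> a u v; rewrite /amp_inner mulr_sumr -big_split; apply: eq_bigr => s _.
by rewrite !ffunE coef_dot_linear.
Qed.

Lemma amp_inner_bilinear : bilinear_for *%R (idfun \; *%R) amp_inner.
Proof.
split=> [y|x a u v]; first exact: amp_inner_linear.
by rewrite amp_innerC amp_inner_linear ![amp_inner _ x]amp_innerC.
Qed.
HB.instance Definition _ := bilinear_isBilinear.Build R W W R
  *%R (idfun \; *%R) amp_inner amp_inner_bilinear.

Lemma amp_inner_hermitian x y :
  amp_inner x y = (-1) ^+ false * idfun (amp_inner y x).
Proof. by rewrite expr0 mul1r amp_innerC. Qed.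
HB.instance Definition _ := isHermitianSesquilinear.Build R W false idfun
  amp_inner amp_inner_hermitian.

Lemma amp_inner_gt0 (x : W) : x != 0 -> 0 < amp_inner x x.
Proof.
move=> x0; have [s xs] : exists s, x s != 0.
  apply: contrapT => nx; case/eqP: x0; apply/ffunP=> s; rewrite ffunE.
  by apply: contrapT => /eqP xs; apply: nx; exists s.
rewrite /amp_inner (bigD1 s)//= ltr_pwDl ?coef_dot_gt0//.
by apply: sumr_ge0 => t _; apply: coef_dot_ge0.
Qed.
HB.instance Definition _ := isDotProduct.Build R W amp_inner amp_inner_gt0.

Lemma coef_dot_sum (J K : finType) (a : J -> R) (p : J -> {poly R})
    (b : K -> R) (q : K -> {poly R}) :
  coef_dot (\sum_j a j *: p j) (\sum_k b k *: q k) =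
  \sum_j \sum_k a j * b k * coef_dot (p j) (q k).
Proof.
have suml (L : finType) (c : L -> R) (r : L -> {poly R}) r' :
    coef_dot (\sum_l c l *: r l) r' = \sum_l c l * coef_dot (r l) r'.
  elim/big_rec2: _ => [|l y x _ <-]; last exact: coef_dot_linear.
  by rewrite /coef_dot size_poly0 big_ord0.
rewrite suml; apply: eq_bigr => j _.
rewrite coef_dotC suml mulr_sumr; apply: eq_bigr => k _.
by rewrite mulrA coef_dotC.
Qed.

Lemma coef_dot_shift k l (p q : {poly R}) :
  coef_dot (shift k p) (shift l q) = if k == l then coef_dot p q else 0.
Proof.
rewrite /shift coef_dot_sum; pose n := maxn (size p) (size q).
have pickE (i j : nat) :
    (pickle (k, i) == pickle (l, j)) = (k == l) && (i == j).
  by rewrite (inj_eq (pcan_inj pickleK)) xpair_eqE.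
under eq_bigr => i _ do under eq_bigr => j _ do rewrite coef_dotXn pickE.
case: eqP => _ /=; last by rewrite big1// => i _; rewrite big1// => j _; rewrite mulr0.
apply: eq_bigr => i _; have [qi|qi] := ltnP i (size q).
  rewrite (bigD1 (Ordinal qi))//= eqxx mulr1 big1 ?addr0// => j.
  by rewrite -val_eqE eq_sym /= => /negPf->; rewrite mulr0.
rewrite [q`_i]nth_default// mulr0 big1// => j _.
by rewrite gtn_eqF ?mulr0//; apply: leq_trans qi.
Qed.

Lemma amp_act1 x : amp_act 1%g x = x.
Proof.
apply/ffunP=> s; rewrite ffunE (bigD1 s)//= mr_coef1 eqxx scale1r big1 ?addr0//.
by move=> t ts; rewrite mr_coef1 eq_sym (negPf ts) scale0r.
Qed.

Lemma amp_actM g h x : amp_act (g * h)%g x = amp_act g (amp_act h x).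
Proof.
apply/ffunP=> s; rewrite !ffunE.
under eq_bigr do rewrite mr_coefM scaler_suml.
rewrite exchange_big; apply: eq_bigr => r _; rewrite ffunE scaler_sumr.
by apply: eq_bigr => t _; rewrite scalerA.
Qed.

Lemma amp_act_isometry g x y : amp_inner (amp_act g x) (amp_act g y) = amp_inner x y.
Proof.
rewrite /amp_inner; under eq_bigr do rewrite !ffunE coef_dot_sum.
rewrite exchange_big; apply: eq_bigr => t _; rewrite exchange_big (bigD1 t)//=.
rewrite [X in _ + X]big1 ?addr0 => [|r rt].
  by rewrite -mulr_suml mr_orthogonal eqxx mul1r.
by rewrite -mulr_suml mr_orthogonal eq_sym (negPf rt) mul0r.
Qed.

(** The orthogonal direct sum of countably many copies of [M]: a polynomial
    stands for the finitely supported sequence of its coefficients. *)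
Definition amplification : orthogonal_rep R gT :=
  @OrthogonalRep R gT W amp_inner amp_act amp_act1 amp_actM amp_act_isometry.
Local Notation U := amplification.
Local Notation "''[' x , y ]" := (inner U x y).

Definition single (s : I) (p : {poly R}) : U := [ffun t => if t == s then p else 0].

Lemma inner_single s t p q : '[single s p, single t q] = if s == t then coef_dot p q else 0.
Proof.
have dot0 r : coef_dot 0 r = 0 by rewrite /coef_dot size_poly0 big_ord0.
rewrite /= /amp_inner (bigD1 s)//= !ffunE eqxx big1 ?addr0.
  by case: eqP => // _; rewrite coef_dotC dot0.
by move=> r rs; rewrite !ffunE (negPf rs) dot0.
Qed.

(** The numbers are paired with a coordinate and an exponent by Euclidean
    division by the dimension of [M]. *)
Lemma amplification_countable : (0 < #|I|)%N -> countably_infinite_dim U.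
Proof.
move=> I0; have /card_gt0P[s0 _] := I0.
pose idx m := nth s0 (enum I) (m %% #|I|).
pose b m : U := single (idx m) 'X^(m %/ #|I|).
have idx_eq m n : (idx m == idx n) = (m %% #|I| == n %% #|I|)%N.
  by rewrite nth_uniq ?enum_uniq// -cardE ltn_mod.
have bb m n : '[b m, b n] = (m == n)%:R.
  rewrite inner_single coef_dotXn idx_eq.
  have [->|mn] := eqVneq m n; first by rewrite !eqxx.
  case: eqP => // Em; case: eqP => // Ed; case/eqP: mn.
  by rewrite (div.divn_eq m #|I|) (div.divn_eq n #|I|) Em Ed.
have eb m : expands b (b m).
  apply: expands_self => [j mj|]; first by rewrite bb (negPf mj).
  by rewrite bb eqxx scale1r.
have es s k : expands b (single s 'X^k).
  have si : (index s (enum I) < #|I|)%N by rewrite cardE index_mem mem_enum.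
  rewrite (_ : single s _ = b (k * #|I| + index s (enum I))%N)//.
  rewrite /b /idx modnMDl modn_small// nth_index ?mem_enum//.
  by rewrite divnMDl// divn_small// addn0.
exists b; split=> [n c sum0 i|x].
  have := congr1 (fun y => '[y, b i]) sum0; rewrite inner0l inner_suml.
  rewrite (bigD1 i)// innerZl bb eqxx mulr1 big1 => [|j /andP[_ ji]].
    by rewrite /= addr0.
  by rewrite innerZl bb (inj_eq val_inj) (negPf ji) mulr0.
have [N /(_ N (leqnn N))] : expands b x.
  have -> : x = \sum_s \sum_(k < size (x s)) (x s)`_k *: single s 'X^k.
    apply/ffunP=> t; rewrite sum_ffunE (bigD1 t)//= sum_ffunE [X in _ + X]big1 ?addr0.
      rewrite -{1}[x t]coefK poly_def; apply: eq_bigr => k _.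
      by rewrite !ffunE eqxx.
    move=> s st; rewrite sum_ffunE big1// => k _.
    by rewrite !ffunE eq_sym (negPf st) scaler0.
  by apply: expands_sum => s; apply: expands_sum => k; apply: expandsZ.
by exists N, (fun k => '[x, b k]).
Qed.

Definition amp_shift (k : nat) (x : U) : U := [ffun s => shift k (x s)].

Lemma amp_shift_linear k : linear (amp_shift k).
Proof. by move=> a x y; apply/ffunP=> s; rewrite !ffunE shift_linear. Qed.

Lemma amp_shift_equivariant k g x : amp_shift k (act U g x) = act U g (amp_shift k x).
Proof.
pose f : {linear {poly R} -> {poly R}} :=
  HB.pack (shift k) (GRing.isLinear.Build _ _ _ _ _ (shift_linear k)).
apply/ffunP=> s; rewrite !ffunE -[shift k]/(f : _ -> _) linear_sum.
by apply: eq_bigr => t _; rewrite linearZ ffunE.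
Qed.

(** The shifts embed the whole of [U] in itself infinitely often, a fortiori each
    of its subrepresentations; a vector fixed in [M] stays fixed in [U]. *)
Lemma amplification_universe (v : I -> R) (s : I) : v s != 0 ->
  (forall g s, \sum_t mr_coef g s t * v t = v s) -> is_universe U.
Proof.
move=> vs vfix; split=> [|V _ _|].
- by apply: amplification_countable; apply/card_gt0P; exists s.
- pose f k : {linear U -> U} :=
    HB.pack (amp_shift k) (GRing.isLinear.Build _ _ _ _ _ (amp_shift_linear k)).
  exists f.
  split=> [k g x _|k l x y _ _] /=; first exact: amp_shift_equivariant.
  rewrite /amp_inner; under eq_bigr do rewrite !ffunE coef_dot_shift.
  by case: eqP => // _; rewrite big1.
- exists ([ffun t => (v t)%:P] : U).
    apply/eqP => /ffunP/(_ s); rewrite !ffunE => /eqP.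
    by rewrite polyC_eq0 (negPf vs).
  move=> g; apply/ffunP=> t; rewrite !ffunE -(vfix g t) rmorph_sum /=.
  by apply: eq_bigr => r _; rewrite ffunE -mul_polyC polyCM.
Qed.

Lemma single_orthonormal_orbit (H : {group gT}) s :
  (forall h, h \in H -> mr_coef h s s = (h == 1%g)%:R) ->
  orthonormal_orbit H (single s 1).
Proof.
move=> Hs h /Hs <-.
have -> : act U h (single s 1) = \sum_t mr_coef h t s *: single t 1.
  apply/ffunP=> r; rewrite sum_ffunE ffunE (bigD1 s)//= big1 ?addr0; last first.
    by move=> t ts; rewrite ffunE (negPf ts) scaler0.
  rewrite (bigD1 r)//= big1 ?addr0 ?ffunE ?eqxx//.
  by move=> t tr; rewrite !ffunE eq_sym (negPf tr) scaler0.
rewrite inner_suml (bigD1 s)// big1 => [|t /andP[_ ts]].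
  by rewrite [LHS]addr0 innerZl inner_single eqxx -(expr0 'X) coef_dotXn eqxx mulr1.
by rewrite innerZl inner_single (negPf ts) mulr0.
Qed.

Lemma regular_transfer (H : {group gT}) (s : I) : is_universe U ->
  (forall h, h \in H -> mr_coef h s s = (h == 1%g)%:R) ->
  linear_isometries_transfer U 1%G H.
Proof.
by move=> U_universe /single_orthonormal_orbit; apply: orthonormal_orbit_transfer.
Qed.

End Amplification.

(** * Translations, rotations and direct sums *)

Section MatrixReps.
Local Open Scope ring_scope.
Variables (R : realType) (gT : finGroupType).
Local Notation matrix_rep := (matrix_rep R gT).

Lemma sum_indicator (I : finType) (a : I) (F : I -> R) :
  \sum_r (r == a)%:R * F r = F a.
Proof.
rewrite (bigD1 a)//= eqxx mul1r big1 ?addr0// => r /negPf->.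
by rewrite mul0r.
Qed.

Section Translation.
Variable f : gT -> gT.
Hypothesis fM : forall g h, f (g * h)%g = (f g * f h)%g.

Definition translation_coef (g s t : gT) : R := (s == (f g * t)%g)%:R.

Lemma translation_coef1 s t : translation_coef 1%g s t = (s == t)%:R.
Proof.
have f1 : f 1%g = 1%g by apply: (mulgI (f 1%g)); rewrite -fM !mulg1.
by rewrite /translation_coef f1 mul1g.
Qed.

Lemma translation_coefM g h s t : translation_coef (g * h)%g s t =
  \sum_r translation_coef g s r * translation_coef h r t.
Proof.
under eq_bigr do rewrite mulrC.
by rewrite sum_indicator /translation_coef fM mulgA.
Qed.

Lemma translation_coef_orthogonal g s t :
  \sum_r translation_coef g r s * translation_coef g r t = (s == t)%:R.
Proof. by rewrite sum_indicator /translation_coef (inj_eq (mulgI _)). Qed.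

Definition translation_rep : matrix_rep :=
  MatrixRep translation_coef1 translation_coefM translation_coef_orthogonal.

End Translation.

Section Rotation.
Variables (c s : gT -> R).
Hypotheses (c1 : c 1%g = 1) (s1 : s 1%g = 0).
Hypothesis cM : forall g h, c (g * h)%g = c g * c h - s g * s h.
Hypothesis sM : forall g h, s (g * h)%g = s g * c h + c g * s h.
Hypothesis cs1 : forall g, c g ^+ 2 + s g ^+ 2 = 1.

Definition rotation_coef (g : gT) (i j : bool) : R :=
  if i == j then c g else if i then s g else - s g.

Lemma rotation_coef1 i j : rotation_coef 1%g i j = (i == j)%:R.
Proof. by case: i j => [] []; rewrite /rotation_coef /= ?c1 ?s1 ?oppr0. Qed.

Lemma rotation_coefM g h i j : rotation_coef (g * h)%g i j =
  \sum_r rotation_coef g i r * rotation_coef h r j.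
Proof.
by rewrite big_bool; case: i j => [] []; rewrite /rotation_coef /= ?cM ?sM; ring.
Qed.

Lemma rotation_coef_orthogonal g i j :
  \sum_r rotation_coef g r i * rotation_coef g r j = (i == j)%:R.
Proof.
rewrite big_bool; case: i j => [] []; rewrite /rotation_coef /= -?(cs1 g); ring.
Qed.

Definition rotation_rep : matrix_rep :=
  MatrixRep rotation_coef1 rotation_coefM rotation_coef_orthogonal.

End Rotation.

Section DirectSum.
Variables A B : matrix_rep.
Local Notation I := (mr_index A + mr_index B)%type.

Definition sum_coef (g : gT) (s t : I) : R :=
  match s, t with
  | inl i, inl j => mr_coef g i j
  | inr i, inr j => mr_coef g i j
  | _, _ => 0
  end.

Lemma sum_coef1 s t : sum_coef 1%g s t = (s == t)%:R.
Proof. by case: s t => [i|i] [j|j] //=; rewrite mr_coef1. Qed.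

Lemma sum_coefM g h s t : sum_coef (g * h)%g s t =
  \sum_r sum_coef g s r * sum_coef h r t.
Proof.
rewrite big_sumType; case: s t => [i|i] [j|j] /=; rewrite ?mr_coefM.
- by rewrite [X in _ + X]big1 ?addr0// => k _; rewrite mul0r.
- by rewrite !big1 ?addr0// => k _; rewrite ?mul0r ?mulr0.
- by rewrite !big1 ?addr0// => k _; rewrite ?mul0r ?mulr0.
- by rewrite [X in X + _]big1 ?add0r// => k _; rewrite mul0r.
Qed.

Lemma sum_coef_orthogonal g s t :
  \sum_r sum_coef g r s * sum_coef g r t = (s == t)%:R.
Proof.
rewrite big_sumType; case: s t => [i|i] [j|j] /=.
- by rewrite [X in _ + X]big1 ?addr0 ?mr_orthogonal// => k _; rewrite mul0r.
- by rewrite !big1 ?addr0// => k _; rewrite ?mul0r ?mulr0.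
- by rewrite !big1 ?addr0// => k _; rewrite ?mul0r ?mulr0.
- by rewrite [X in X + _]big1 ?add0r ?mr_orthogonal// => k _; rewrite mul0r.
Qed.

Definition sum_rep : matrix_rep :=
  MatrixRep sum_coef1 sum_coefM sum_coef_orthogonal.

Local Notation U := (amplification sum_rep).

Lemma act_inl g (x : U) i :
  act U g x (inl i) = \sum_j mr_coef g i j *: x (inl j).
Proof.
by rewrite ffunE big_sumType /= [X in _ + X]big1 ?addr0// => j _; rewrite scale0r.
Qed.

Lemma act_inr g (x : U) i :
  act U g x (inr i) = \sum_j mr_coef g i j *: x (inr j).
Proof.
by rewrite ffunE big_sumType /= [X in X + _]big1 ?add0r// => j _; rewrite scale0r.
Qed.

Definition trivial_coef (M : matrix_rep) g : Prop :=
  forall s t : mr_index M, mr_coef g s t = (s == t)%:R.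

Lemma sum_trivial_coef (M : matrix_rep) g (x : mr_index M -> {poly R}) i :
  trivial_coef M g -> \sum_j mr_coef g i j *: x j = x i.
Proof.
move=> Mg; rewrite (bigD1 i)//= Mg eqxx scale1r big1 ?addr0// => j ji.
by rewrite Mg eq_sym (negPf ji) scale0r.
Qed.

Lemma act_inl_trivial g (x : U) i : trivial_coef A g -> act U g x (inl i) = x (inl i).
Proof. by rewrite act_inl => /(sum_trivial_coef (x \o inl))->. Qed.

Lemma act_inr_trivial g (x : U) i : trivial_coef B g -> act U g x (inr i) = x (inr i).
Proof. by rewrite act_inr => /(sum_trivial_coef (x \o inr))->. Qed.

Lemma act_inl0 g (x : U) : (forall i, x (inl i) = 0) -> forall i, act U g x (inl i) = 0.
Proof. by move=> x0 i; rewrite act_inl big1// => j _; rewrite x0 scaler0. Qed.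

Lemma act_inr0 g (x : U) : (forall i, x (inr i) = 0) -> forall i, act U g x (inr i) = 0.
Proof. by move=> x0 i; rewrite act_inr big1// => j _; rewrite x0 scaler0. Qed.

(** [1 - z] kills the second summand and [1 - y] the first. *)
Lemma act_difference_inl_inr y z (x : U) : trivial_coef A y -> trivial_coef B z ->
  act U y (x - act U z x) = x - act U z x.
Proof.
move=> Ay Bz; apply/ffunP => -[i|i]; first by rewrite act_inl_trivial.
have w0 j : (x - act U z x) (inr j) = 0.
  by rewrite 2!ffunE act_inr_trivial// subrr.
by rewrite act_inr0 ?w0.
Qed.

Lemma act_difference_inr_inl y z (x : U) : trivial_coef B y -> trivial_coef A z ->
  act U y (x - act U z x) = x - act U z x.
Proof.
move=> By Az; apply/ffunP => -[i|i]; last by rewrite act_inr_trivial.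
have w0 j : (x - act U z x) (inl j) = 0.
  by rewrite 2!ffunE act_inl_trivial// subrr.
by rewrite act_inl0 ?w0.
Qed.

Lemma sum_universe (v : mr_index A -> R) i : v i != 0 ->
  (forall g i, \sum_j mr_coef g i j * v j = v i) -> is_universe U.
Proof.
move=> vi vfix; pose w (s : mr_index sum_rep) := if s is inl j then v j else 0.
apply: (@amplification_universe _ _ _ w (inl i)) => // g [j|j].
  rewrite big_sumType /= vfix [X in _ + X]big1 ?addr0// => k _.
  by rewrite mulr0.
rewrite big_sumType /= !big1 ?addr0// => k _; rewrite ?mulr0//.
by rewrite mul0r.
Qed.

End DirectSum.
End MatrixReps.

(** * Transfer systems on a cyclic group of order [p q] *)

Section Subgroups.
Variables (gT : finGroupType) (p q : nat).
Hypotheses (p_prime : prime p) (q_prime : prime q) (p_neq_q : p != q).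
Hypotheses (gT_cyclic : cyclic [set: gT]) (gT_order : #|gT| = (p * q)%N).
Local Notation P := (subgroup_of_order gT p).
Local Notation Q := (subgroup_of_order gT q).
Local Notation G := [set: gT]%G.
Implicit Types K H : {group gT}.

Lemma card_fst_subgroup : #|P| = p.
Proof. by rewrite card_subgroup_of_order// gT_order dvdn_mulr. Qed.

Lemma card_snd_subgroup : #|Q| = q.
Proof. by rewrite card_subgroup_of_order// gT_order dvdn_mull. Qed.

Lemma coprime_pq : coprime p q.
Proof. by rewrite prime_coprime// dvdn_prime2. Qed.

Lemma prime_subgroups_TI : P :&: Q = 1%g.
Proof. by apply: coprime_TIg; rewrite card_fst_subgroup card_snd_subgroup coprime_pq. Qed.

Lemma prime_subgroups_mulG : (P * Q)%g = G.
Proof.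
apply/eqP; rewrite eqEcard finset.subsetT TI_cardMg ?prime_subgroups_TI//.
by rewrite card_fst_subgroup card_snd_subgroup cardsT gT_order /=.
Qed.

Lemma subgroup_cases K : [\/ K = 1%G, K = P, K = Q | K = G].
Proof.
have KE := subgroup_of_orderP K gT_cyclic.
have : #|K| %| p * q by rewrite -gT_order -cardsT cardSg ?finset.subsetT.
have [pK|pK] := boolP (p %| #|K|).
  have [k kE] := dvdnP pK; rewrite kE mulnC dvdn_pmul2l ?prime_gt0// => kq.
  have [k1|k1] := eqVneq k 1%N.
    by apply: Or42; rewrite -KE kE k1 mul1n.
  have kq' : k = q by apply/(prime_nt_dvdP q_prime k1).
  apply: Or44; apply/val_inj/eqP; rewrite eqEcard finset.subsetT /=.
  by rewrite kE kq' cardsT gT_order mulnC.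
rewrite Gauss_dvdr ?(coprime_sym #|K|) ?prime_coprime// => Kq.
have [K1|K1] := eqVneq #|K| 1%N.
  by apply: Or41; apply/val_inj/card1_trivg.
apply: Or43; rewrite -KE; congr (subgroup_of_order _ _).
exact/(prime_nt_dvdP q_prime K1).
Qed.

Lemma prime_subgroup_not_sub : ~~ (P \subset Q).
Proof.
apply/negP => sPQ; have := prime_subgroups_TI; rewrite (finset.setIidPl sPQ) => P1.
by have := card_fst_subgroup; rewrite P1 cards1 => p1; move: p_prime; rewrite -p1.
Qed.

End Subgroups.

Section Edges.
Variables (gT : finGroupType) (p q : nat).
Hypotheses (p_prime : prime p) (q_prime : prime q) (p_neq_q : p != q).
Hypotheses (gT_cyclic : cyclic [set: gT]) (gT_order : #|gT| = (p * q)%N).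
Local Notation P := (subgroup_of_order gT p).
Local Notation Q := (subgroup_of_order gT q).
Local Notation G := [set: gT]%G.
Implicit Types T : {group gT} -> {group gT} -> Prop.

Let gT_order' : #|gT| = (q * p)%N. Proof. by rewrite gT_order mulnC. Qed.
Let q_neq_p : q != p. Proof. by rewrite eq_sym. Qed.

(** Restricting [P -> G] along [Q] gives [P :&: Q -> Q]. *)
Lemma edge_restr T : transfer_system T -> T P G -> T 1%G Q.
Proof.
move=> tT /(ts_restr tT)/(_ (finset.subsetT Q)).
by rewrite (_ : (P :&: Q)%G = 1%G)//; apply/val_inj/prime_subgroups_TI.
Qed.

Lemma edge_top T : transfer_system T -> saturated T ->
  T 1%G G <-> T 1%G P /\ T P G.
Proof.
move=> tT sT; split=> [TG|[aT cT]]; last exact: ts_trans tT _ _ _ aT cT.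
by apply: sT TG _ _; [apply: sub1G|apply: finset.subsetT].
Qed.

(** The subgroups are [1], [P], [Q] and [G], and the relation [1 -> G] amounts to
    the two relations [1 -> P] and [P -> G]. *)
Lemma same_relation_edges T S :
  transfer_system T -> saturated T -> transfer_system S -> saturated S ->
  (T 1%G P <-> S 1%G P) -> (T 1%G Q <-> S 1%G Q) ->
  (T P G <-> S P G) -> (T Q G <-> S Q G) -> same_relation T S.
Proof.
move=> tT sT tS sS a b c d K H.
have e : T 1%G G <-> S 1%G G by rewrite !edge_top// a c.
have [sKH|nKH] := boolP (K \subset H); last first.
  by split=> [/(ts_sub tT)|/(ts_sub tS)] sKH; rewrite sKH in nKH.
have refl L : T L L <-> S L L by split=> _; apply: ts_refl.
have nPQ := prime_subgroup_not_sub p_prime q_prime p_neq_q gT_cyclic gT_order.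
have nQP := prime_subgroup_not_sub q_prime p_prime q_neq_p gT_cyclic gT_order'.
have below (L M : {group gT}) : ~~ (L \subset M) -> ~~ (G \subset M).
  by apply: contra; apply: fintype.subset_trans; apply: finset.subsetT.
have nontriv (L M : {group gT}) : ~~ (L \subset M) -> ~~ (L \subset 1%G).
  by apply: contra => sL1; apply: fintype.subset_trans sL1 (sub1G M).
have cases := subgroup_cases p_prime q_prime gT_cyclic gT_order.
have [] := cases K => KE; have [] := cases H => HE; move: sKH;
  rewrite KE HE // => sKH; exfalso; move: sKH; apply/negP.
- exact: nontriv nPQ.
- exact: nPQ.
- exact: nontriv nQP.
- exact: nQP.
- exact: nontriv (below _ _ nPQ).
- exact: below nQP.
- exact: below nPQ.
Qed.

End Edges.

(** * Universes generated by permutation representations *)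

Section PowerRep.
Local Open Scope ring_scope.
Variables (R : realType) (gT : finGroupType).
Hypothesis gT_cyclic : cyclic [set: gT].

Lemma power_morph m (g h : gT) : ((g * h) ^+ m = g ^+ m * h ^+ m)%g.
Proof.
apply: expgMn; apply: (centsP (cyclic_abelian gT_cyclic)); exact: finset.in_setT.
Qed.

(** As a representation of [gT], a multiple of the permutation representation
    on the quotient by the kernel of the [m]-th power map. *)
Definition power_rep m : matrix_rep R gT := translation_rep R (power_morph m).

Lemma power_rep_fixed m (g s : gT) :
  \sum_t mr_coef (m := power_rep m) g s t * 1 = 1.
Proof.
rewrite (reindex_inj (mulgI (g ^+ m)^-1%g)) /=.
under eq_bigr do rewrite /translation_coef mulKVg eq_sym.
exact: (sum_indicator s (fun=> 1)).
Qed.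

Lemma power_rep_universe m : is_universe (amplification (power_rep m)).
Proof.
apply: (@amplification_universe _ _ (power_rep m) (fun=> 1) 1%g).
  exact: oner_neq0.
exact: power_rep_fixed.
Qed.

Lemma power_sum_universe m (M : matrix_rep R gT) :
  is_universe (amplification (sum_rep (power_rep m) M)).
Proof.
apply: (@sum_universe _ _ (power_rep m) M (fun=> 1) 1%g); first exact: oner_neq0.
exact: power_rep_fixed.
Qed.

Lemma power_rep_trivial m g : (g ^+ m = 1)%g -> trivial_coef (power_rep m) g.
Proof. by move=> gm s t; rewrite /= /translation_coef gm mul1g. Qed.

Lemma power_rep_regular m (H : {group gT}) :
  (forall h, h \in H -> (h ^+ m = 1)%g -> h = 1%g) ->
  forall h, h \in H -> mr_coef (m := power_rep m) h 1%g 1%g = (h == 1%g)%:R.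
Proof.
move=> Hm h Hh; rewrite /= /translation_coef mulg1 eq_sym.
have [->|h1] := eqVneq h 1%g; first by rewrite expg1n eqxx.
by case: eqP => // /(Hm _ Hh) hE; rewrite hE eqxx in h1.
Qed.

Lemma power_acts_trivially m (H : {group gT}) :
  (forall h, h \in H -> (h ^+ m = 1)%g) ->
  acts_trivially (amplification (power_rep m)) H.
Proof.
move=> Hm h x /Hm/power_rep_trivial hm; apply/ffunP=> s.
by rewrite ffunE sum_trivial_coef.
Qed.

End PowerRep.

Section Exponents.
Variables (gT : finGroupType) (p q : nat).
Hypotheses (p_prime : prime p) (q_prime : prime q) (p_neq_q : p != q).
Hypotheses (gT_cyclic : cyclic [set: gT]) (gT_order : #|gT| = (p * q)%N).
Local Notation P := (subgroup_of_order gT p).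

Lemma prime_subgroup_expg h : h \in P -> (h ^+ p = 1)%g.
Proof. by move/expg_cardG; rewrite (card_fst_subgroup gT_cyclic gT_order). Qed.

Lemma prime_subgroup_expg_eq1 h : h \in P -> (h ^+ q = 1)%g -> h = 1%g.
Proof.
move=> /prime_subgroup_expg hp hq; apply/eqP; rewrite -order_eq1 -dvdn1.
rewrite -(eqP (coprime_pq p_prime q_prime p_neq_q)) dvdn_gcd.
by rewrite !order_dvdn hp hq eqxx.
Qed.

End Exponents.

Section Realizations.
Variables (R : realType) (gT : finGroupType) (p q : nat).
Hypotheses (p_prime : prime p) (q_prime : prime q) (p_neq_q : p != q).
Hypotheses (gT_cyclic : cyclic [set: gT]) (gT_order : #|gT| = (p * q)%N).
Local Notation P := (subgroup_of_order gT p).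
Local Notation Q := (subgroup_of_order gT q).
Local Notation G := [set: gT]%G.
Variable T : {group gT} -> {group gT} -> Prop.
Hypotheses (T_transfer : transfer_system T) (T_saturated : saturated T).

Let gT_order' : #|gT| = (q * p)%N. Proof. by rewrite gT_order mulnC. Qed.
Let q_neq_p : q != p. Proof. by rewrite eq_sym. Qed.
Let PexpP := prime_subgroup_expg gT_cyclic gT_order.
Let QexpQ := prime_subgroup_expg gT_cyclic gT_order'.
Let PexpQ := prime_subgroup_expg_eq1 p_prime q_prime p_neq_q gT_cyclic gT_order.
Let QexpP := prime_subgroup_expg_eq1 q_prime p_prime q_neq_p gT_cyclic gT_order'.
Let nPQ := prime_subgroup_not_sub p_prime q_prime p_neq_q gT_cyclic gT_order.
Let nQP := prime_subgroup_not_sub q_prime p_prime q_neq_p gT_cyclic gT_order'.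
Let tiPQ := prime_subgroups_TI p_prime q_prime p_neq_q gT_cyclic gT_order.
Let PQ_G := prime_subgroups_mulG p_prime q_prime p_neq_q gT_cyclic gT_order.

Let nP1 : ~~ (P \subset 1%G).
Proof. by apply: contra nPQ => sP1; apply: fintype.subset_trans sP1 (sub1G Q). Qed.
Let nQ1 : ~~ (Q \subset 1%G).
Proof. by apply: contra nQP => sQ1; apply: fintype.subset_trans sQ1 (sub1G P). Qed.

Local Notation transfer := linear_isometries_transfer.

Lemma realized_edges (U : orthogonal_rep R gT) : is_universe U ->
  (T 1%G P <-> transfer U 1%G P) -> (T 1%G Q <-> transfer U 1%G Q) ->
  (T P G <-> transfer U P G) -> (T Q G <-> transfer U Q G) ->
  realized R T.
Proof.
move=> U_universe a b c d; exists U => //.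
apply: (same_relation_edges p_prime q_prime p_neq_q gT_cyclic gT_order) => //.
  exact: linear_isometries_transfer_system.
exact: linear_isometries_transfer_saturated.
Qed.

(** In the universe with the trivial character only, no translate is orthogonal. *)
Lemma trivial_realized : ~ T 1%G P -> ~ T 1%G Q -> ~ T P G -> ~ T Q G ->
  realized R T.
Proof.
move=> a b c d; pose U := amplification (power_rep R gT_cyclic 0).
have U_universe : is_universe U by apply: power_rep_universe.
have triv H : acts_trivially U H.
  by apply: power_acts_trivially => h _; rewrite expg0.
have none (K H L : {group gT}) : L \subset H -> ~~ (L \subset K) -> ~ transfer U K H.
  move=> sLH /negP nLK t; apply: nLK.
  exact: (acts_trivially_no_transfer U_universe t sLH (triv L)).
apply: (realized_edges U_universe); split=> // t; exfalso; move: t.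
- exact: (none _ _ P).
- exact: (none _ _ Q).
- by apply: (none _ _ Q) => //; apply: finset.subsetT.
- by apply: (none _ _ P) => //; apply: finset.subsetT.
Qed.

(** The universe of all characters of [gT] has a regular orbit, so [1 -> G], and
    saturation gives the rest. *)
Lemma complete_realized : T 1%G P -> T 1%G Q -> T P G -> T Q G -> realized R T.
Proof.
move=> a b c d; pose U := amplification (power_rep R gT_cyclic 1).
have U_universe : is_universe U by apply: power_rep_universe.
have top : transfer U 1%G G.
  apply: (regular_transfer (s := 1%g : mr_index (power_rep R gT_cyclic 1))) => //.
  by apply: power_rep_regular => h _; rewrite expg1.
have edge (H : {group gT}) : transfer U 1%G H /\ transfer U H G.
  by apply: linear_isometries_transfer_saturated top _ _;
    [exact: sub1G|exact: finset.subsetT].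
by apply: (realized_edges U_universe); split=> // _; have [] := edge P;
  have [] := edge Q.
Qed.

(** The characters that are trivial on [P]: the restriction to [Q] is regular. *)
Lemma over_P_realized : ~ T 1%G P -> T 1%G Q -> T P G -> ~ T Q G -> realized R T.
Proof.
move=> a b c d; pose U := amplification (power_rep R gT_cyclic p).
have U_universe : is_universe U by apply: power_rep_universe.
have triv : acts_trivially U P by apply: power_acts_trivially.
have tQ : transfer U 1%G Q.
  apply: (regular_transfer (s := 1%g : mr_index (power_rep R gT_cyclic p))) => //.
  by apply: power_rep_regular.
apply: (realized_edges U_universe); split=> // t.
- case/negP: nP1; exact: (acts_trivially_no_transfer U_universe t _ triv).
- exact: (acts_trivially_transfer triv tiPQ).
- case/negP: nPQ.
  by apply: (acts_trivially_no_transfer U_universe t _ triv); apply: finset.subsetT.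
Qed.

(** The characters that are trivial on [P] or on [Q]: they restrict to all
    characters of [P] and to all characters of [Q], but none is nontrivial on
    both, so the set is not a union of cosets of the characters trivial on [P],
    or on [Q]. *)
Lemma no_edge_to_top_realized : T 1%G P -> T 1%G Q -> ~ T P G -> ~ T Q G ->
  realized R T.
Proof.
move=> a b c d.
pose A := power_rep R gT_cyclic p; pose B := power_rep R gT_cyclic q.
pose U := amplification (sum_rep A B).
have U_universe : is_universe U by apply: power_sum_universe.
have trA y : y \in P -> trivial_coef A y by move/PexpP/power_rep_trivial; apply.
have trB y : y \in Q -> trivial_coef B y by move/QexpQ/power_rep_trivial; apply.
have tQ : transfer U 1%G Q.
  apply: (regular_transfer (s := inl 1%g : mr_index (sum_rep A B))) => //.
  by apply: power_rep_regular.
have tP : transfer U 1%G P.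
  apply: (regular_transfer (s := inr 1%g : mr_index (sum_rep A B))) => //.
  by apply: power_rep_regular.
apply: (realized_edges U_universe); split=> // t; exfalso.
- case/negP: nP1; apply: (acts_trivially_no_transfer U_universe tP) => //.
  apply: (transfer_acts_trivially t (finset.subsetT Q) nQP) => y z x yQ zP.
  by apply: act_difference_inr_inl; [apply: trB|apply: trA].
- case/negP: nQ1; apply: (acts_trivially_no_transfer U_universe tQ) => //.
  apply: (transfer_acts_trivially t (finset.subsetT P) nPQ) => y z x yP zQ.
  by apply: act_difference_inl_inr; [apply: trA|apply: trB].
Qed.

End Realizations.

(** * The rotation of order [q] *)

Section RotationCharacter.
Local Open Scope ring_scope.
Variables (R : realType) (gT : finGroupType) (p q : nat).
Hypotheses (p_gt0 : (0 < p)%N) (q_gt2 : (2 < q)%N).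
Hypotheses (gT_cyclic : cyclic [set: gT]) (gT_order : #|gT| = (p * q)%N).
Local Notation P := (subgroup_of_order gT p).

Let theta : R := pi *+ 2 / q%:R.

Let q_neq0 : (q%:R : R) != 0.
Proof. by rewrite pnatr_eq0; case: q q_gt2. Qed.

Lemma angle_modn (f : R -> R) : periodic f (pi *+ 2) ->
  forall i j, (i = j %[mod q])%N -> f (theta *+ i) = f (theta *+ j).
Proof.
move=> fper i j ij; rewrite (div.divn_eq i q) (div.divn_eq j q) ij.
have thetaq : theta *+ q = pi *+ 2 by rewrite -mulr_natr divfK.
have red k l : f (theta *+ (k * q + l)) = f (theta *+ l).
  by rewrite mulrnDr mulnC mulrnA thetaq addrC periodicn.
by rewrite !red.
Qed.

(** The composite of a surjection of [gT] onto the integers modulo [q], whose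
    kernel is [P], with the rotations of angle [2 pi k / q]. *)
Lemma exists_rotation : exists c s : gT -> R,
  [/\ [/\ c 1%g = 1, s 1%g = 0,
      forall g h, c (g * h)%g = c g * c h - s g * s h,
      forall g h, s (g * h)%g = s g * c h + c g * s h &
      forall g, c g ^+ 2 + s g ^+ 2 = 1],
      forall h, h \in P -> c h = 1 /\ s h = 0 &
      exists g, s g != 0].
Proof.
have /cyclicP[a aG] := gT_cyclic.
have oa : #[a]%g = (p * q)%N by rewrite orderE -aG cardsT.
have /choice[k kE] g : exists k, g = (a ^+ k)%g.
  by apply/cycleP; rewrite -aG finset.in_setT.
have kmod g n : g = (a ^+ n)%g -> (k g = n %[mod q])%N.
  move=> gn; have: (a ^+ k g == a ^+ n)%g by rewrite -kE -gn.
  rewrite eq_expg_mod_order oa => /eqP/(congr1 (modn^~ q)).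
  by rewrite !modn_dvdm ?dvdn_mull.
have cosk := angle_modn (@cosD2pi R); have sink := angle_modn (@sinD2pi R).
have angleM g h : theta *+ (k g + k h)%N = theta *+ k g + theta *+ k h.
  exact: mulrnDr.
have kM g h : (k (g * h)%g = k g + k h %[mod q])%N.
  by apply: kmod; rewrite expgD -!kE.
exists (fun g => cos (theta *+ k g)), (fun g => sin (theta *+ k g)).
have k0 h : (k h = 0 %[mod q])%N -> cos (theta *+ k h) = 1 /\ sin (theta *+ k h) = 0.
  by move=> h0; rewrite (cosk _ _ h0) (sink _ _ h0) mulr0n cos0 sin0.
split; first split.
- by apply: (k0 1%g _).1; apply: kmod; rewrite expg0.
- by apply: (k0 1%g _).2; apply: kmod; rewrite expg0.
- by move=> g h; rewrite (cosk _ _ (kM g h)) angleM cosD.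
- by move=> g h; rewrite (sink _ _ (kM g h)) angleM sinD.
- by move=> g; apply: cos2Dsin2.
- move=> h /(prime_subgroup_expg gT_cyclic gT_order); rewrite {1}(kE h) -expgM => /eqP.
  rewrite -order_dvdn oa mulnC dvdn_pmul2r ?p_gt0// => qk; apply: k0.
  by rewrite mod0n; apply/eqP.
- exists a; rewrite (sink _ 1%N) ?mulr1n; last by apply: kmod; rewrite expg1.
  have q0 : 0 < q%:R :> R by rewrite ltr0n; case: q q_gt2.
  have pi0 : 0 < pi :> R := pi_gt0 R.
  rewrite gt_eqF//; apply: sin_gt0_pi; apply/andP; split.
    by rewrite divr_gt0// -[pi *+ 2]mulr_natr mulr_gt0.
  by rewrite ltr_pdivrMr// -[pi *+ 2]mulr_natr ltr_pM2l// ltr_nat.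
Qed.

End RotationCharacter.

Section OneSidedRealization.
Variables (R : realType) (gT : finGroupType) (p q : nat).
Hypotheses (p_prime : prime p) (q_prime : prime q) (p_neq_q : p != q).
Hypotheses (gT_cyclic : cyclic [set: gT]) (gT_order : #|gT| = (p * q)%N).
Hypothesis (q_gt3 : (3 < q)%N).
Local Notation P := (subgroup_of_order gT p).
Local Notation Q := (subgroup_of_order gT q).
Local Notation G := [set: gT]%G.
Local Notation transfer := linear_isometries_transfer.

(** The characters that are trivial on [Q], and one pair of conjugate nontrivial
    characters that are trivial on [P]. They restrict to all characters of [P],
    but to three characters of [Q] only, which is too few when [q > 3]. *)
Lemma one_sided_realized (T : {group gT} -> {group gT} -> Prop) :
  transfer_system T -> saturated T ->
  T 1%G P -> ~ T 1%G Q -> ~ T Q G -> realized R T.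
Proof.
move=> tT sT a b d.
have c : ~ T P G by move/(edge_restr p_prime q_prime p_neq_q gT_cyclic gT_order tT).
have gT_order' : #|gT| = (q * p)%N by rewrite gT_order mulnC.
have q_neq_p : q != p by rewrite eq_sym.
have nPQ := prime_subgroup_not_sub p_prime q_prime p_neq_q gT_cyclic gT_order.
have [co [si [[c1 s1 cM sM cs1] Ptriv [g0 g0s]]]] :=
  exists_rotation R (prime_gt0 p_prime) (ltnW q_gt3) gT_cyclic gT_order.
pose A := power_rep R gT_cyclic q; pose B := rotation_rep c1 s1 cM sM cs1.
pose U := amplification (sum_rep A B).
have U_universe : is_universe U by apply: power_sum_universe.
have trA y : y \in Q -> trivial_coef A y.
  by move/(prime_subgroup_expg gT_cyclic gT_order')/power_rep_trivial; apply.
have trB y : y \in P -> trivial_coef B y.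
  by move=> /Ptriv[cy sy] [] []; rewrite /= /rotation_coef /= ?cy ?sy ?oppr0.
have tP : transfer U 1%G P.
  apply: (regular_transfer (s := inl 1%g : mr_index (sum_rep A B))) => //.
  apply: power_rep_regular.
  exact: prime_subgroup_expg_eq1 p_prime q_prime p_neq_q gT_cyclic gT_order.
have nQ : ~ transfer U 1%G Q.
  have /cyclicP[z Qz] : cyclic Q by apply: cyclicS (finset.subsetT _) gT_cyclic.
  have zQ : z \in Q by rewrite Qz cycle_id.
  apply: (cubic_no_transfer U_universe (c := co z) zQ).
    by rewrite orderE -Qz (card_fst_subgroup gT_cyclic gT_order').
  move=> x /=; set w := (_ - x)%R.
  have evalD (u v : U) s : (u + v)%R s = (u s + v s)%R by rewrite ffunE.
  have evalN (u : U) s : (- u)%R s = (- u s)%R by rewrite ffunE.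
  have evalZ k (u : U) s : (k *: u)%R s = (k *: u s)%R by rewrite ffunE.
  have w0 j : w (inl j) = 0%R.
    by rewrite evalD evalN act_inl_trivial ?subrr//; apply: trA.
  clearbody w; apply/ffunP => -[i|i]; rewrite !(evalD, evalN, evalZ).
    rewrite !act_inl0 ?w0 ?scaler0 ?subr0 ?addr0 ?ffunE// => j.
    exact: act_inl0.
  have cs : ((co z)%:P ^+ 2 + (si z)%:P ^+ 2 = 1 :> {poly R})%R.
    by rewrite -!rmorphXn -rmorphD cs1.
  rewrite !act_inr !big_bool !act_inr !big_bool ffunE.
  have rot (j k : bool) : mr_coef (m := B) z j k =
    (if j == k then co z else if j then si z else - si z)%R by [].
  case: i; rewrite !rot /= -!mul_polyC !rmorphN !rmorphD /=.
    set C := (co z)%:P%R in cs *; set S := (si z)%:P%R in cs *.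
    transitivity ((1 - (C ^+ 2 + S ^+ 2)) * w (inr true))%R; first by ring.
    by rewrite cs subrr mul0r.
  set C := (co z)%:P%R in cs *; set S := (si z)%:P%R in cs *.
  transitivity ((1 - (C ^+ 2 + S ^+ 2)) * w (inr false))%R; first by ring.
  by rewrite cs subrr mul0r.
apply: (realized_edges p_prime q_prime p_neq_q gT_cyclic gT_order tT sT U_universe);
  split=> // t; exfalso.
  have tU := linear_isometries_transfer_system U.
  exact: nQ (edge_restr p_prime q_prime p_neq_q gT_cyclic gT_order tU t).
have Qtriv : acts_trivially U Q.
  apply: (transfer_acts_trivially t (finset.subsetT P) nPQ) => y z x yP zQ.
  by apply: act_difference_inr_inl; [apply: trB|apply: trA].
have /mulsgP[y z yP zQ g0E] : g0 \in (P * Q)%g.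
  by rewrite (prime_subgroups_mulG p_prime q_prime p_neq_q gT_cyclic gT_order) finset.in_setT.
pose x : U := single (inr true : mr_index (sum_rep A B)) 1%R.
have : act U g0 x (inr false) = x (inr false).
  by rewrite g0E actM (Qtriv z _ zQ); apply: act_inr_trivial; apply: trB.
rewrite act_inr big_bool !ffunE /= /rotation_coef /= scaler0 addr0.
by move/eqP; rewrite scaler_eq0 oner_eq0 orbF oppr_eq0 (negPf g0s).
Qed.

End OneSidedRealization.

(** * Which saturated transfer systems are realized *)

Section SmallPrime.
Variables (R : realType) (gT : finGroupType) (p q : nat).
Hypotheses (p_prime : prime p) (q_prime : prime q) (p_neq_q : p != q).
Hypotheses (gT_cyclic : cyclic [set: gT]) (gT_order : #|gT| = (p * q)%N).
Local Notation P := (subgroup_of_order gT p).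
Local Notation Q := (subgroup_of_order gT q).
Local Notation G := [set: gT]%G.

(** When [p <= 3], the trivial character and one pair of conjugate nontrivial ones
    exhaust the characters of [P]. Without the relation [1 -> P] the action of
    [P] is therefore trivial, and then [1 -> Q] entails [P -> G]. *)
Lemma small_prime_not_realized : (p <= 3)%N ->
  ~ realized R (only_nontrivial 1%G Q).
Proof.
move=> p3 [U U_universe same].
have gT_order' : #|gT| = (q * p)%N by rewrite gT_order mulnC.
have q_neq_p : q != p by rewrite eq_sym.
have nPQ := prime_subgroup_not_sub p_prime q_prime p_neq_q gT_cyclic gT_order.
have nQP := prime_subgroup_not_sub q_prime p_prime q_neq_p gT_cyclic gT_order'.
have P1 : P <> 1%G by move=> P1; case/negP: nPQ; rewrite P1 sub1G.
have Ptriv : acts_trivially U P.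
  apply: contrapT => nP.
  have [||u Hu] := orthonormal_orbit_prime_le3 U_universe _ _ nP;
    rewrite ?(card_fst_subgroup gT_cyclic gT_order)//.
  have /same[/esym//|[_ PQ]] := orthonormal_orbit_transfer U_universe Hu.
  by case/negP: nPQ; rewrite PQ.
have : only_nontrivial 1%G Q P G.
  apply/same; apply: (acts_trivially_transfer Ptriv).
  - exact: prime_subgroups_TI p_prime q_prime p_neq_q gT_cyclic gT_order.
  - exact: prime_subgroups_mulG p_prime q_prime p_neq_q gT_cyclic gT_order.
  - by apply/same; right.
by case=> [PG|[//]]; case/negP: nQP; rewrite PG; apply: finset.subsetT.
Qed.

Lemma same_relation_only_nontrivial (T : {group gT} -> {group gT} -> Prop) :
  transfer_system T -> saturated T ->
  T 1%G P -> ~ T 1%G Q -> ~ T Q G -> same_relation T (only_nontrivial 1%G P).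
Proof.
move=> tT sT a b d.
have c : ~ T P G by move/(edge_restr p_prime q_prime p_neq_q gT_cyclic gT_order tT).
have gT_order' : #|gT| = (q * p)%N by rewrite gT_order mulnC.
have q_neq_p : q != p by rewrite eq_sym.
have nPQ := prime_subgroup_not_sub p_prime q_prime p_neq_q gT_cyclic gT_order.
have nQP := prime_subgroup_not_sub q_prime p_prime q_neq_p gT_cyclic gT_order'.
have pG : p %| #|gT| by rewrite gT_order dvdn_mulr.
have [tS sS] := only_nontrivial_saturated gT_cyclic p_prime pG.
apply: (same_relation_edges p_prime q_prime p_neq_q gT_cyclic gT_order) => //;
  split=> //; first by right.
- by case=> [Q1|[_ QP]]; exfalso; case/negP: nQP; [rewrite -Q1 sub1G|rewrite QP].
- case=> [PG|[P1 _]]; exfalso; last by case/negP: nPQ; rewrite P1 sub1G.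
  by case/negP: nQP; rewrite PG finset.subsetT.
- case=> [QG|[Q1 _]]; exfalso; last by case/negP: nQP; rewrite Q1 sub1G.
  by case/negP: nPQ; rewrite QG finset.subsetT.
Qed.

End SmallPrime.

(** Restriction, transitivity and saturation leave seven combinations of the
    relations [1 -> P], [1 -> Q], [P -> G] and [Q -> G]: all; none; [P -> G] and
    [1 -> Q]; [Q -> G] and [1 -> P]; or one or both of [1 -> P] and [1 -> Q]. *)
Lemma saturated_realized (R : realType) (gT : finGroupType) (p q : nat)
    (T : {group gT} -> {group gT} -> Prop) :
  prime p -> prime q -> p != q -> cyclic [set: gT] -> #|gT| = (p * q)%N ->
  transfer_system T -> saturated T ->
  (3 < q)%N \/ ~ same_relation T (only_nontrivial 1%G (subgroup_of_order gT p)) ->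
  (3 < p)%N \/ ~ same_relation T (only_nontrivial 1%G (subgroup_of_order gT q)) ->
  realized R T.
Proof.
move=> pp qp pq cG oG tT sT notTp notTq.
have qneqp : q != p by rewrite eq_sym.
have oG' : #|gT| = (q * p)%N by rewrite oG mulnC.
set P := subgroup_of_order gT p in notTp; set Q := subgroup_of_order gT q in notTq.
pose G := [set: gT]%G.
have cb := edge_restr pp qp pq cG oG tT.
have da := edge_restr qp pp qneqp cG oG' tT.
have top1 := edge_top p tT sT; have top2 := edge_top q tT sT.
have [c|c] := EM (T P G).
  have b := cb c; have [a|a] := EM (T 1%G P).
    have [_ d] : T 1%G Q /\ T Q G by apply/top2/top1.
    exact (complete_realized R pp qp pq cG oG tT sT a b c d).
  by apply: (over_P_realized R pp qp pq cG oG tT sT a b c) => /da.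
have [d|d] := EM (T Q G).
  have a := da d; have [b|b] := EM (T 1%G Q).
    have [_ c'] : T 1%G P /\ T P G by apply/top1/top2.
    by case: c.
  exact: (over_P_realized R qp pp qneqp cG oG' tT sT b a d c).
have [a|a] := EM (T 1%G P); have [b|b] := EM (T 1%G Q).
- exact (no_edge_to_top_realized R pp qp pq cG oG tT sT a b c d).
- case: notTp => [q3|[]].
    exact (one_sided_realized R pp qp pq cG oG q3 tT sT a b d).
  exact (same_relation_only_nontrivial pp qp pq cG oG tT sT a b d).
- case: notTq => [p3|[]].
    exact (one_sided_realized R qp pp qneqp cG oG' p3 tT sT b a c).
  exact (same_relation_only_nontrivial qp pp qneqp cG oG' tT sT b a c).
- exact (trivial_realized R pp qp pq cG oG tT sT a b c d).
Qed.

(** Saturation holds over any finite group. *)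
Lemma realized_saturated (R : realType) (gT : finGroupType)
    (T : {group gT} -> {group gT} -> Prop) : realized R T -> saturated T.
Proof.
case=> U _ same K L H /same tKH sKL sLH.
by have [] := linear_isometries_transfer_saturated tKH sKL sLH; rewrite -!same.
Qed.

Theorem theorem5p19 (R : realType) (gT : finGroupType) (p q : nat)
    (p_prime : prime p) (q_prime : prime q) (p_lt_q : (p < q)%N)
    (gT_cyclic : cyclic [set: gT]) (gT_order : #|gT| = (p * q)%N) :
  let Tp := only_nontrivial 1%G (subgroup_of_order gT p) in
  let Tq := only_nontrivial 1%G (subgroup_of_order gT q) in
  (p = 2 /\ q = 3 ->
     (forall T : {group gT} -> {group gT} -> Prop,
        transfer_system T -> saturated T ->
        ~ same_relation T Tp -> ~ same_relation T Tq -> realized R T)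
     /\ ~ realized R Tp /\ ~ realized R Tq) /\
  ((p = 2 \/ p = 3) /\ (3 < q)%N ->
     (forall T : {group gT} -> {group gT} -> Prop,
        transfer_system T -> saturated T ->
        ~ same_relation T Tq -> realized R T)
     /\ ~ realized R Tq) /\
  ((3 < p)%N /\ (3 < q)%N ->
     forall T : {group gT} -> {group gT} -> Prop,
       transfer_system T -> (realized R T <-> saturated T)).
Proof.
move=> Tp Tq.
have p_neq_q : p != q by rewrite neq_ltn p_lt_q.
have q_neq_p : q != p by rewrite eq_sym.
have gT_order' : #|gT| = (q * p)%N by rewrite gT_order mulnC.
have realize T := @saturated_realized R gT p q T p_prime q_prime p_neq_q
  gT_cyclic gT_order.
have notTq := small_prime_not_realized (R := R) p_prime q_prime p_neq_q gT_cyclic gT_order.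
have notTp := small_prime_not_realized (R := R) q_prime p_prime q_neq_p gT_cyclic gT_order'.
split; first move=> [p2 q3]; last split.
- split; last by split; [apply: notTp; rewrite q3|apply: notTq; rewrite p2].
  by move=> T tT sT nTp nTq; apply: realize => //; right.
- move=> [p23 q3]; split; last by apply: notTq; case: p23 => ->.
  by move=> T tT sT nTq; apply: realize => //; [left|right].
- move=> [p3 q3] T tT; split; first exact: realized_saturated.
  by move=> sT; apply: realize => //; left.
Qed.
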